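(* The following are equivalent for a matroid $M$. (i) Both $M$ and its dual $M^*$ are laminar. (ii) Each component of $M$ is either a nested matroid or is a truncation to some non-zero rank of the direct sum of two uniform matroids of positive rank.
   Context: All matroids are finite. A family $\mathcal{A}$ of subsets of a finite set $E$ is laminar if, for all $A,B\in\mathcal{A}$ with $A\cap B\neq\emptyset$, either $A\subseteq B$ or $B\subseteq A$. Given a laminar family $\mathcal{A}$ of subsets of $E$ and a capacity function $c:\mathcal{A}\to\mathbb{Z}_{\ge 0}$, $M(E,\mathcal{A},c)$ is the matroid on $E$ whose independent sets are exactly the sets $I\subseteq E$ with $|I\cap A|\le c(A)$ for all $A\in\mathcal{A}$. A matroid is laminar if it is isomorphic to some $M(E,\mathcal{A},c)$. A transversal matroid is nested if it has a transversal presentation $(B_1,B_2,\dots,B_n)$ with $B_1\subseteq B_2\subseteq\dots\subseteq B_n$ (so the independent sets are the partial transversals of this sequence of sets). The truncation of a matroid $N$ to rank $r\le r(N)$ is the matroid on $E(N)$ whose independent sets are the independent sets of $N$ of size at most $r$. A component of $M$ is the restriction of $M$ to a connected component of its ground set. *)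

(* Defs.v *)
From mathcomp Require Import all_boot.

Set Implicit Arguments.
Unset Strict Implicit.
Unset Printing Implicit Defensive.

(* The axioms are boolean so that a matroid is determined, up to Leibniz      *)
(* equality, by its ground set and its independent sets (see [matroid_eq]).   *)
Definition matroid_axioms (T : finType) (E : {set T}) (F : {set {set T}}) :=
  [&& set0 \in F,
      [forall I in F, I \subset E],
      [forall J in F, forall I : {set T}, (I \subset J) ==> (I \in F)]
    & [forall I in F, forall J in F,
         (#|I| < #|J|) ==> [exists x in J :\: I, x |: I \in F]]].

(* The ground set is a subset of the ambient type [T], not [T] itself.        *)
Record matroid (T : finType) := Matroid {
  ground : {set T};
  indep : {set {set T}};
  matroidP : matroid_axioms ground indep }.

Section BasicFacts.
Variable T : finType.
Implicit Types (M : matroid T) (E I J : {set T}) (F : {set {set T}}).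

Lemma matroid_eq M N : ground M = ground N -> indep M = indep N -> M = N.
Proof.
case: M N => [E F ax] [E' F' ax'] /= eqE eqF.
by subst E' F'; rewrite (bool_irrelevance ax ax').
Qed.

Lemma matroid_axiomsI E F :
    set0 \in F ->
    (forall I, I \in F -> I \subset E) ->
    (forall I J, J \in F -> I \subset J -> I \in F) ->
    (forall I J, I \in F -> J \in F -> #|I| < #|J| ->
       exists2 x, x \in J :\: I & x |: I \in F) ->
  matroid_axioms E F.
Proof.
move=> F0 FE Fsub Faug; apply/and4P; split=> //.
- by apply/forall_inP.
- by apply/forall_inP=> J FJ; apply/forallP=> I; apply/implyP; apply: Fsub.
- apply/forall_inP=> I FI; apply/forall_inP=> J FJ; apply/implyP=> ltIJ.
  by apply/exists_inP; apply: Faug.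
Qed.

Lemma indep0 M : set0 \in indep M.
Proof. by case/and4P: (matroidP M). Qed.

Lemma indep_ground M I : I \in indep M -> I \subset ground M.
Proof. by case/and4P: (matroidP M) => _ /forall_inP + _ _; apply. Qed.

Lemma indep_sub M I J : J \in indep M -> I \subset J -> I \in indep M.
Proof.
by case/and4P: (matroidP M) => _ _ /forall_inP h _ /h /forallP/(_ I)/implyP.
Qed.

Lemma indep_aug M I J : I \in indep M -> J \in indep M -> #|I| < #|J| ->
  exists2 x, x \in J :\: I & x |: I \in indep M.
Proof.
case/and4P: (matroidP M) => _ _ _ /forall_inP h /h /forall_inP h' /h' /implyP h2.
by move=> /h2 /exists_inP.
Qed.

End BasicFacts.

Definition rank (T : finType) (M : matroid T) := \max_(I in indep M) #|I|.

Definition bases (T : finType) (M : matroid T) :=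
  [set B | maxset [pred I in indep M] B].

Definition circuits (T : finType) (M : matroid T) :=
  [set C | minset [pred D : {set T} | D \subset ground M & D \notin indep M] C].

Section Dual.
Variables (T : finType) (M : matroid T).

(* The bases of the dual are the complements in [ground M] of the bases of M. *)
Definition dual_indep :=
  [set I : {set T} | [exists B in bases M, I \subset ground M :\: B]].

Lemma card_bases B I : B \in bases M -> I \in indep M -> #|I| <= #|B|.
Proof.
rewrite inE => /maxsetP[/= BM maxB] IM; rewrite leqNgt; apply/negP => lt.
have [x] := indep_aug BM IM lt; rewrite inE => /andP[xB _] /maxB.
by move=> /(_ (subsetUr _ _)) eqB; move: xB; rewrite -eqB setU11.
Qed.

Lemma dual_axioms : matroid_axioms (ground M) dual_indep.
Proof.
have ex_base I J : I \in indep M -> J \in bases M ->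
    exists B, [/\ B \in bases M, I \subset B & B \subset I :|: J].
  move=> IM JM; pose P := [pred K in indep M | K \subset I :|: J].
  have PI : P I by rewrite /= IM subsetUl.
  have [B /maxsetP[/= /andP[BM BIJ] maxB] IB] := maxset_exists PI.
  exists B; split=> //; rewrite inE; apply/maxsetP; split=> //= K KM BK.
  apply/esym/eqP; rewrite eqEcard BK /=; apply: leq_trans (card_bases JM KM) _.
  rewrite leqNgt; apply/negP => lt.
  have JM' : J \in indep M by move: JM; rewrite inE => /maxsetp.
  have [x] := indep_aug BM JM' lt; rewrite inE => /andP[xB xJ] xBM.
  have := maxB (x |: B); rewrite xBM /= subUset sub1set inE xJ orbT BIJ.
  by move=> /(_ isT (subsetUr _ _)) eqB; move: xB; rewrite -eqB setU11.
apply: matroid_axiomsI.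
- have P0 : [pred I in indep M] set0 by exact: indep0.
  have [B maxB _] := maxset_exists P0.
  by rewrite inE; apply/exists_inP; exists B; rewrite ?inE ?sub0set.
- move=> I; rewrite inE => /exists_inP[B _ /subset_trans]; apply.
  exact: subsetDl.
- move=> I J; rewrite !inE => /exists_inP[B BM JB] IJ.
  by apply/exists_inP; exists B => //; apply: subset_trans JB.
- move=> I J; rewrite !inE => /exists_inP[BI BIM]; rewrite subsetD.
  case/andP=> IE dI /exists_inP[BJ BJM]; rewrite subsetD => /andP[JE dJ] lt.
  have BJi : BJ :\: I \in indep M.
    by move: BJM; rewrite inE => /maxsetp/indep_sub; apply; apply: subsetDl.
  have [B [BM sB Bs]] := ex_base _ _ BJi BIM.
  have dIB : [disjoint I & B].
    rewrite disjoint_sym; apply: disjointWl Bs _.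
    rewrite disjoints_subset subUset setDE subsetIr -disjoints_subset.
    by rewrite disjoint_sym.
  have [/subsetP sJ|/subsetPn[x]] := boolP (J :\: I \subset B); last first.
    rewrite inE => /andP[xI xJ] xB; exists x; first by rewrite inE xI.
    rewrite inE; apply/exists_inP; exists B => //.
    rewrite subUset sub1set !inE xB (subsetP JE) //=.
    by rewrite subsetD IE.
  have: #|B| <= #|BJ|.
    by apply: card_bases => //; move: BM; rewrite inE => /maxsetp.
  have le : #|(BJ :\: I) :|: (J :\: I)| <= #|B|.
    by rewrite subset_leq_card // subUset sB; apply/subsetP.
  move=> /(leq_trans le).
  have /eqP-> : #|BJ :\: I :|: (J :\: I)| == #|BJ :\: I| + #|J :\: I|.
    rewrite (leq_card_setU (BJ :\: I) (J :\: I)).2.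
    apply: disjointWl (subsetDl _ _) _; apply: disjointWr (subsetDl _ _) _.
    by rewrite disjoint_sym.
  rewrite -[leqRHS](cardsID I) addnC leq_add2r leqNgt => /negP[].
  apply: (@leq_ltn_trans #|I :\: J|).
    apply: subset_leq_card; apply/subsetP => y; rewrite !inE => /andP[yB ->].
    by rewrite andbT; apply: contraL yB => /(disjointFr dJ) ->.
  by rewrite -(ltn_add2l #|I :&: J|) cardsID setIC cardsID.
Qed.

Definition dual : matroid T := Matroid dual_axioms.

End Dual.

Section Restriction.
Variables (T : finType) (M : matroid T) (X : {set T}).

Lemma restriction_axioms :
  matroid_axioms (ground M :&: X) [set I in indep M | I \subset X].
Proof.
apply: matroid_axiomsI; first by rewrite inE indep0 sub0set.
- by move=> I; rewrite inE subsetI => /andP[/indep_ground-> ->].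
- move=> I J; rewrite !inE => /andP[JM JX] IJ.
  by rewrite (indep_sub JM IJ) (subset_trans IJ).
- move=> I J; rewrite !inE => /andP[IM IX] /andP[JM JX] lt.
  have [x xJI xM] := indep_aug IM JM lt; exists x => //.
  rewrite inE xM subUset sub1set IX andbT (subsetP JX) //.
  by move: xJI; rewrite inE => /andP[].
Qed.

Definition restriction : matroid T := Matroid restriction_axioms.

End Restriction.

Section Truncation.
Variables (T : finType) (r : nat) (M : matroid T).

Lemma truncation_axioms :
  matroid_axioms (ground M) [set I in indep M | #|I| <= r].
Proof.
apply: matroid_axiomsI; first by rewrite inE indep0 cards0.
- by move=> I; rewrite inE => /andP[/indep_ground].
- move=> I J; rewrite !inE => /andP[JM Jr] IJ.
  by rewrite (indep_sub JM IJ) (leq_trans (subset_leq_card IJ)).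
- move=> I J; rewrite !inE => /andP[IM Ir] /andP[JM Jr] lt.
  have [x xJI xM] := indep_aug IM JM lt; exists x => //.
  move: xJI; rewrite !inE xM cardsU1 => /andP[-> _].
  exact: leq_trans lt Jr.
Qed.

Definition truncation : matroid T := Matroid truncation_axioms.

End Truncation.

Section DirectSum.
Variables (T : finType) (M N : matroid T).
Hypothesis disMN : [disjoint ground M & ground N].

Lemma direct_sum_axioms :
  matroid_axioms (ground M :|: ground N)
    [set I :|: J | I in indep M, J in indep N].
Proof.
have dIJ I J : I \in indep M -> J \in indep N -> [disjoint I & J].
  move=> /indep_ground IM /indep_ground JN.
  exact: disjointWl IM (disjointWr JN disMN).
have cardU I J : I \in indep M -> J \in indep N -> #|I :|: J| = #|I| + #|J|.
  by move=> IM JN; apply/eqP; rewrite (leq_card_setU I J).2 dIJ.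
apply: matroid_axiomsI.
- by apply/imset2P; exists set0 set0; rewrite ?indep0 ?setU0.
- by move=> _ /imset2P[I J /indep_ground IM /indep_ground JN ->]; apply: setUSS.
- move=> K _ /imset2P[I J IM JN ->] sK; apply/imset2P.
  exists (K :&: I) (K :&: J); last by rewrite -setIUr; apply/esym/setIidPl.
    by apply: indep_sub IM _; apply: subsetIr.
  by apply: indep_sub JN _; apply: subsetIr.
- move=> _ _ /imset2P[I J IM JN ->] /imset2P[I' J' IM' JN' ->].
  rewrite !cardU // => lt; have [ltI|leI] := ltnP #|I| #|I'|.
    have [x] := indep_aug IM IM' ltI; rewrite !inE => /andP[xI xI'] xM.
    exists x; last by rewrite setUA; apply/imset2P; exists (x |: I) J.
    rewrite !inE (negPf xI) xI' /= andbT; apply/negP => xJ.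
    have xgM := subsetP (indep_ground IM') _ xI'.
    by have := disjointFr disMN xgM; rewrite (subsetP (indep_ground JN)).
  have ltJ : #|J| < #|J'|.
    by rewrite -(ltn_add2l #|I'|); apply: leq_trans lt; rewrite ltnS leq_add2r.
  have [x] := indep_aug JN JN' ltJ; rewrite !inE => /andP[xJ xJ'] xN.
  exists x; last by rewrite setUCA; apply/imset2P; exists I (x |: J).
  rewrite !inE (negPf xJ) xJ' orbT andbT orbF; apply/negP => xI.
  have xgM := subsetP (indep_ground IM) _ xI.
  by have := disjointFr disMN xgM; rewrite (subsetP (indep_ground JN')).
Qed.

Definition direct_sum : matroid T := Matroid direct_sum_axioms.

End DirectSum.

Definition uniform (T : finType) (M : matroid T) :=
  exists2 k, k <= #|ground M|
           & indep M = [set I : {set T} | I \subset ground M & #|I| <= k].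

(* An element always lies in its own class, even if it is in no circuit.      *)
Definition same_component (T : finType) (M : matroid T) : rel T :=
  fun x y => (x == y) || [exists C in circuits M, (x \in C) && (y \in C)].

Definition connected_components (T : finType) (M : matroid T) :
    {set {set T}} :=
  equivalence_partition (same_component M) (ground M).

Definition is_component (T : finType) (N M : matroid T) :=
  exists2 X, X \in connected_components M & N = restriction M X.

(* The map sends subsets of the ground set of M, seen as sets over the        *)
(* subtype, to subsets of the ground set of N.                                *)
Definition isomorphic (T U : finType) (M : matroid T) (N : matroid U) :=
  exists2 f : {x | x \in ground M} -> {y | y \in ground N},
    bijective f
    & forall I : {set {x | x \in ground M}},
        ([set val x | x in I] \in indep M)
        = ([set val (f x) | x in I] \in indep N).

Definition laminar_family (T : finType) (E : {set T}) (A : {set {set T}}) :=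
  (forall X, X \in A -> X \subset E) /\
  (forall X Y, X \in A -> Y \in A -> X :&: Y != set0 ->
     X \subset Y \/ Y \subset X).

Section LaminarMatroid.
Variables (T : finType) (E : {set T}) (A : {set {set T}}) (c : {set T} -> nat).
Hypothesis lamA : laminar_family E A.

Definition laminar_indep :=
  [set I : {set T} | I \subset E & [forall X in A, #|I :&: X| <= c X]].

Lemma laminar_axioms : matroid_axioms E laminar_indep.
Proof.
apply: matroid_axiomsI.
- by rewrite inE sub0set; apply/forall_inP => X _; rewrite set0I cards0.
- by move=> I; rewrite inE => /andP[].
- move=> I J; rewrite !inE => /andP[JE /forall_inP Jc] IJ.
  rewrite (subset_trans IJ JE); apply/forall_inP => X XA.
  by apply: leq_trans (Jc X XA); rewrite subset_leq_card ?setSI.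
move=> I J; rewrite !inE => /andP[IE /forall_inP Ic] /andP[JE /forall_inP Jc].
move=> lt; apply/exists_inP; apply: contraLR lt => /exists_inPn nox.
rewrite -leqNgt.
pose tight := [pred X in A | #|I :&: X| == c X].
pose P := [set X | maxset tight X].
have PA X : X \in P -> X \in A /\ #|I :&: X| = c X.
  by rewrite inE => /maxsetp /andP[-> /eqP].
have tP : trivIset P.
  apply/trivIsetP => X Y XP YP; apply: contraR; rewrite -setI_eq0 => XY.
  have [XA _] := PA _ XP; have [YA _] := PA _ YP.
  move: XP YP; rewrite !inE => /maxsetP[tX mX] /maxsetP[tY mY].
  have [s|s] := lamA.2 _ _ XA YA XY; first by rewrite (mX _ tY s).
  by rewrite (mY _ tX s).
have cov x : x \in J :\: I -> x \in cover P.
  move=> xJI; have := nox x xJI; move: xJI; rewrite !inE => /andP[xI xJ].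
  rewrite subUset sub1set IE (subsetP JE) //= => /forall_inPn[X XA].
  rewrite -ltnNge => ltX.
  have xX : x \in X.
    apply: contraLR ltX => xX; rewrite -leqNgt.
    rewrite setIUl (_ : [set x] :&: X = set0) ?set0U ?Ic //.
    by apply/setP => y; rewrite !inE; case: eqP => // ->; rewrite (negPf xX).
  have tX : tight X.
    rewrite /= XA eqn_leq Ic //= -ltnS; apply: leq_trans ltX _.
    rewrite setIUl; apply: leq_trans (leq_card_setU _ _).1 _.
    rewrite -add1n leq_add2r -(cards1 x); apply: subset_leq_card.
    exact: subsetIl.
  have [Y mY XY] := maxset_exists tX.
  by apply/bigcupP; exists Y; rewrite ?inE // (subsetP XY).
have cardP (K : {set T}) : #|K :&: cover P| = \sum_(X in P) #|K :&: X|.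
  rewrite -sum1_card (eq_bigl (fun x => (x \in cover P) && (x \in K))).
    rewrite big_trivIset_cond //; apply: eq_bigr => X _.
    by rewrite -sum1_card; apply: eq_bigl => x; rewrite inE andbC.
  by move=> x; rewrite inE andbC.
rewrite -(cardsID (cover P) J) -(cardsID (cover P) I) leq_add //.
  rewrite !cardP; apply: leq_sum => X /PA[XA ->]; exact: Jc.
apply: subset_leq_card; apply/subsetP => x; rewrite !inE => /andP[xP xJ].
by rewrite xP; apply: contraR xP => xI; apply: cov; rewrite inE xI.
Qed.

Definition laminar_matroid : matroid T := Matroid laminar_axioms.

End LaminarMatroid.

Definition laminar (T : finType) (M : matroid T) :=
  exists (U : finType) (E : {set U}) (A : {set {set U}}) (c : {set U} -> nat)
         (lamA : laminar_family E A),
    isomorphic M (laminar_matroid c lamA).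

(* Each x in I is assigned to the member of index [phi x]; the default value  *)
(* set0 of nth forces [phi x] to be a valid index.                            *)
Definition partial_transversal (T : finType) (B : seq {set T}) (I : {set T}) :=
  exists2 phi : T -> nat,
    {in I &, injective phi} & forall x, x \in I -> x \in nth set0 B (phi x).

Definition transversal_presentation (T : finType) (M : matroid T)
    (B : seq {set T}) :=
  all (fun X : {set T} => X \subset ground M) B /\
  (forall I : {set T}, I \in indep M <-> partial_transversal B I).

Definition nested (T : finType) (M : matroid T) :=
  exists2 B : seq {set T},
    transversal_presentation M B & sorted (fun X Y : {set T} => X \subset Y) B.

Definition truncated_sum_of_two_uniform (T : finType) (M : matroid T) :=
  exists (U V : matroid T) (disUV : [disjoint ground U & ground V]) (r : nat),
    [/\ uniform U /\ 0 < rank U,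
        uniform V /\ 0 < rank V,
        0 < r <= rank (direct_sum disUV)
      & M = truncation r (direct_sum disUV)].

(* Main.v *)
(* A laminar presentation amounts to a laminar family A such that every       *)
(* circuit C has some F in A with C <= F and [rk F < #|C|]; hence C spans F,  *)
(* and two intersecting circuits are comparable up to closure.                *)
(*   From the components to M: the complements of the members of A capture    *)
(* the cocircuits as soon as the members F tight for an independent set J     *)
(* ([rk F <= #|J :&: F|]) are directed.  This applies to the chain given by a *)
(* nested presentation and to the family of X, Y and [X :|: Y] for a          *)
(* truncated sum of uniform matroids on X and Y.                              *)
(*   From M to a component N: if all circuits of N are comparable, their      *)
(* closures form a chain and N is nested.  Otherwise let C1, C2 be            *)
(* incomparable circuits, so that their closures are disjoint.  If some x     *)
(* lay outside both closures, there would be a cocircuit avoiding cl C1       *)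
(* through x and a point of C2, and one avoiding cl C2 through x and a point  *)
(* of C1.  They meet in x, so laminarity of the dual makes them comparable,   *)
(* against the orthogonality of circuits and cocircuits.  So N is covered by  *)
(* cl C1 and cl C2, and every circuit spans cl C1, cl C2 or N.                *)

Require Import Defs.
From mathcomp Require Import all_boot.
From mathcomp Require Import zify.

Set Implicit Arguments.
Unset Strict Implicit.
Unset Printing Implicit Defensive.

(** * Rank, closure, circuits and components *)

(** The argument runs on rank functions. [laminar_of_capture] and [capture_of_laminar] replace
    laminarity by the intrinsic [laminar_capture], where ranks act as capacities;
    [laminar_capture_circuits] deduces that intersecting circuits are comparable up to closure.
    Components serve M and its dual alike, because being a separator passes to the dual
    ([dual_separator]) and restriction to a separator commutes with duality ([rk_dual_restriction]).

    Sufficiency: [nested_capture] and [truncated_sum_capture] each give a family whose complements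
    capture the cocircuits, by [dual_captures]; [laminar_capture_glue] unites the families of the
    components.

    Necessity is [connected_dichotomy]. If all circuits are comparable, unions of circuits of
    bounded rank give a nested presentation ([nested_of_comparable]). Otherwise two incomparable
    circuits have disjoint closures that cover the ground set ([incomparable_disjoint],
    [incomparable_cover]). A circuit inside one closure spans it, so both restrictions are uniform;
    every other circuit spans everything, so only the total rank constrains further
    ([incomparable_truncated]). *)

Section RankClosure.
Variables (T : finType) (M : matroid T).
Implicit Types (I J B C D X Y Z : {set T}) (x y z : T).

Local Notation E := (ground M).

Definition rk X := \max_(I in [set I in indep M | I \subset X]) #|I|.

Lemma rk_ge I X : I \in indep M -> I \subset X -> #|I| <= rk X.
Proof. by move=> IM IX; apply: leq_bigmax_cond; rewrite inE IM. Qed.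

Lemma rk_witness X : exists I, [/\ I \in indep M, I \subset X & #|I| = rk X].
Proof.
have h : 0 < #|[set I in indep M | I \subset X]|.
  by apply/card_gt0P; exists set0; rewrite inE indep0 sub0set.
have [I] := eq_bigmax_cond (fun I : {set T} => #|I|) h.
by rewrite inE => /andP[IM IX] eqI; exists I.
Qed.

Lemma rk_extend I X : I \in indep M -> I \subset X ->
  exists B, [/\ B \in indep M, I \subset B, B \subset X & #|B| = rk X].
Proof.
move=> IM IX; pose P := [pred K in indep M | K \subset X].
have PI : P I by rewrite /= IM.
have [B /maxsetP[/= /andP[BM BX] maxB] IB] := maxset_exists PI.
exists B; split=> //; apply/eqP; rewrite eqn_leq rk_ge //= leqNgt.
have [K [KM KX <-]] := rk_witness X.
apply/negP => /(indep_aug BM KM)[x]; rewrite inE => /andP[xB xK] xBM.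
have := maxB (x |: B); rewrite xBM /= subUset sub1set (subsetP KX) // BX.
by move=> /(_ isT (subsetUr _ _)) eqB; rewrite -eqB setU11 in xB.
Qed.

Lemma rkS X Y : X \subset Y -> rk X <= rk Y.
Proof.
by move=> XY; have [I [IM IX <-]] := rk_witness X; rewrite rk_ge ?(subset_trans IX).
Qed.

Lemma rk_card X : rk X <= #|X|.
Proof. by have [I [_ IX <-]] := rk_witness X; apply: subset_leq_card. Qed.

Lemma rk0 : rk set0 = 0.
Proof. by apply/eqP; rewrite -leqn0 -(cards0 T) rk_card. Qed.

Lemma rk_indep I : I \in indep M -> rk I = #|I|.
Proof. by move=> IM; apply/eqP; rewrite eqn_leq rk_card rk_ge. Qed.

Lemma indep_rk I : #|I| <= rk I -> I \in indep M.
Proof.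
have [J [JM JI <-]] := rk_witness I => le.
by have /eqP<- : J == I by rewrite eqEcard JI.
Qed.

Lemma rk_ground X : rk (X :&: E) = rk X.
Proof.
apply/eqP; rewrite eqn_leq rkS ?subsetIl //=.
by have [I [IM IX <-]] := rk_witness X; rewrite rk_ge // subsetI IX indep_ground.
Qed.

Lemma rank_rk : rank M = rk E.
Proof. by apply: eq_bigl => I; rewrite !inE andb_idr //; apply: indep_ground. Qed.

Lemma rk_submod X Y : rk (X :|: Y) + rk (X :&: Y) <= rk X + rk Y.
Proof.
have [I [IM IXY <-]] := rk_witness (X :&: Y).
have IU : I \subset X :|: Y.
  by apply: subset_trans IXY _; apply: subset_trans (subsetIl _ _) (subsetUl _ _).
have [B [BM IB BU <-]] := rk_extend IM IU.
have leX : #|B :&: X| <= rk X.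
  by rewrite rk_ge ?subsetIr // (indep_sub BM) ?subsetIl.
have leY : #|B :&: Y| <= rk Y.
  by rewrite rk_ge ?subsetIr // (indep_sub BM) ?subsetIl.
apply: leq_trans (leq_add leX leY).
rewrite -[leqRHS]cardsUI -setIUr setIACA setIid (setIidPl BU) leq_add2l.
by apply: subset_leq_card; rewrite subsetI IB.
Qed.

Lemma rk_submodS Z X Y : Z \subset X -> Z \subset Y ->
  rk (X :|: Y) + rk Z <= rk X + rk Y.
Proof.
move=> ZX ZY; apply: leq_trans (rk_submod X Y).
by rewrite leq_add2l rkS // subsetI ZX.
Qed.

Lemma rkU X Y : rk (X :|: Y) <= rk X + rk Y.
Proof. exact: leq_trans (leq_addr _ _) (rk_submod X Y). Qed.

(** [rk] accepts any subset of [T], whereas [cl X] stays in the ground set; so [X] lies in [cl X]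
    only if it lies in the ground set. *)
Definition cl X := [set x in E | rk (x |: X) == rk X].

Lemma rk_clU X Y : Y \subset cl X -> rk (X :|: Y) = rk X.
Proof.
have [n] := ubnP #|Y|; elim: n Y => // n IH Y /ltnSE leY YX.
have [->|[y yY]] := set_0Vmem Y; first by rewrite setU0.
have eqr : rk (X :|: Y :\ y) = rk X.
  apply: IH; last by rewrite (subset_trans _ YX) ?subsetDl.
  by move: leY; rewrite (cardsD1 y Y) yY.
have /setIdP[_ /eqP eqy] := subsetP YX _ yY.
apply/eqP; rewrite eqn_leq [_ <= rk (_ :|: _)]rkS ?subsetUl // andbT.
have := @rk_submodS X (X :|: Y :\ y) (y |: X) (subsetUl _ _) (subsetUr _ _).
rewrite eqr eqy leq_add2r; congr (rk _ <= _).
by rewrite [y |: X]setUC setUACA setUid [_ :|: [set y]]setUC setD1K.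
Qed.

Lemma cl_sub_ground X : cl X \subset E.
Proof. by apply/subsetP => x /setIdP[]. Qed.

Lemma sub_clP X Y : reflect (Y \subset E /\ rk (X :|: Y) = rk X) (Y \subset cl X).
Proof.
apply: (iffP idP) => [YX|[YE eqr]].
  by split; [apply: subset_trans (cl_sub_ground X) | apply: rk_clU].
apply/subsetP => y yY; rewrite inE (subsetP YE) // eqn_leq.
rewrite [_ <= rk (_ |: _)]rkS ?subsetUr //.
by rewrite andbT -eqr rkS // subUset sub1set subsetUl inE yY orbT.
Qed.

Lemma sub_cl X : X \subset E -> X \subset cl X.
Proof. by move=> XE; apply/sub_clP; rewrite setUid. Qed.

Lemma clS X Y : X \subset Y -> cl X \subset cl Y.
Proof.
move=> XY; apply/subsetP => y /setIdP[yE /eqP eqy]; rewrite inE yE eqn_leq.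
rewrite [_ <= rk (_ |: _)]rkS ?subsetUr // andbT.
have := @rk_submodS X Y (y |: X) XY (subsetUr _ _).
by rewrite eqy leq_add2r setUCA (setUidPl XY).
Qed.

Lemma rk_cl X : rk (cl X) = rk X.
Proof.
apply/eqP; rewrite eqn_leq -{1}(rk_clU (subxx (cl X))) rkS ?subsetUr //.
rewrite -rk_ground rkS //; apply: subset_trans (sub_cl (subsetIr X E)) (clS _).
exact: subsetIl.
Qed.

Lemma cl_min X Y : Y \subset cl X -> cl Y \subset cl X.
Proof.
move=> YX; apply: subset_trans (clS (subsetUr X Y)) _.
apply/subsetP => z /setIdP[zE /eqP]; rewrite (rk_clU YX) => eqz.
rewrite inE zE eqn_leq [_ <= rk (_ |: _)]rkS ?subsetUr // andbT -eqz.
by rewrite rkS // setUS ?subsetUl.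
Qed.

Lemma circuitP C : reflect
  [/\ C \subset E, C \notin indep M & forall x, x \in C -> C :\ x \in indep M]
  (C \in circuits M).
Proof.
rewrite inE; apply: (iffP minsetP) => /= [[/andP[CE nC] minC]|[CE nC minC]].
  split=> // x xC; apply/negPn/negP => nCx.
  have := minC (C :\ x); rewrite nCx (subset_trans _ CE) ?subsetDl //.
  by move=> /(_ isT isT) eqC; rewrite -eqC setD11 in xC.
split=> [|D /andP[_ nD] DC]; first by rewrite CE.
apply/eqP; rewrite eqEsubset DC /=; apply/subsetP => x xC; apply: contraR nD => xD.
by apply: indep_sub (minC x xC) _; rewrite subsetD1 DC.
Qed.

Lemma circuit_ground C : C \in circuits M -> C \subset E.
Proof. by case/circuitP. Qed.

Lemma circuit_rk C : C \in circuits M -> (rk C).+1 = #|C|.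
Proof.
case/circuitP => CE nC minC; apply/eqP; rewrite eqn_leq ltnNge.
rewrite (contra (@indep_rk C)) //=.
have [C0|[x xC]] := set_0Vmem C; first by rewrite C0 indep0 in nC.
by rewrite (cardsD1 x C) xC ltnS -rk_indep ?minC // rkS ?subsetDl.
Qed.

Lemma circuit_rkD1 C x : C \in circuits M -> x \in C -> rk (C :\ x) = rk C.
Proof.
move=> CM xC; have [_ _ minC] := circuitP _ CM.
apply/eqP; rewrite -eqSS (circuit_rk CM) rk_indep ?minC //.
by rewrite (cardsD1 x C) xC.
Qed.

Lemma circuit_cl C x : C \in circuits M -> x \in C -> x \in cl (C :\ x).
Proof.
move=> CM xC; rewrite inE (subsetP (circuit_ground CM)) // setD1K //.
by rewrite circuit_rkD1 ?eqxx.
Qed.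

Lemma circuit_eq C D : C \in circuits M -> D \in circuits M -> D \subset C -> D = C.
Proof.
move=> /circuitP[_ _ minC] /circuitP[_ nD _] DC.
apply/eqP; rewrite eqEsubset DC /=; apply/subsetP => x xC; apply: contraR nD => xD.
by apply: indep_sub (minC x xC) _; rewrite subsetD1 DC.
Qed.

Lemma circuit_neq0 C : C \in circuits M -> C != set0.
Proof. by case/circuitP => _ nC _; apply: contraNneq nC => ->; apply: indep0. Qed.

Lemma dep_circuit X : X \subset E -> X \notin indep M ->
  exists2 C, C \in circuits M & C \subset X.
Proof.
move=> XE nX; pose P := [pred D : {set T} | D \subset E & D \notin indep M].
have [C minC CX] := minset_exists (P := P) (C := X) (introT andP (conj XE nX)).
by exists C; rewrite ?inE.
Qed.

Lemma cl_circuit X x : x \in cl X -> x \notin X ->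
  exists C, [/\ C \in circuits M, x \in C & C \subset x |: X].
Proof.
move=> /setIdP[xE /eqP eqx] xX; have [I [IM IX cI]] := rk_witness X.
have nxI : x |: I \notin indep M.
  apply/negP => /rk_indep eq1.
  have : rk (x |: I) <= rk I by rewrite (rk_indep IM) cI -eqx rkS ?setUS.
  by rewrite eq1 cardsU1 (contra (subsetP IX x)) // (rk_indep IM) ltnn.
have [|C CM CI] := dep_circuit _ nxI.
  by rewrite subUset sub1set xE indep_ground.
exists C; split=> //; last by apply: subset_trans CI (setUS _ IX).
have [_ nC _] := circuitP _ CM; apply: contraR nC => xC.
apply: indep_sub IM _; apply/subsetP => z zC.
by case/setU1P: (subsetP CI z zC) => // eqz; rewrite -eqz zC in xC.
Qed.

(** Without [e] and [f], the rest of the union spans [e] through [D] and then [f] through [C], so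
    [f] closes a circuit there. *)
Lemma strong_elimination C D e f : C \in circuits M -> D \in circuits M ->
    e \in C -> e \in D -> f \in C -> f \notin D ->
  exists K, [/\ K \in circuits M, f \in K & K \subset (C :|: D) :\ e].
Proof.
move=> CM DM eC eD fC fD.
have fe : f != e by apply: contraNneq fD => ->.
set X := (C :|: D) :\ e :\ f.
have XE : X \subset E.
  apply: subset_trans (subsetDl _ _) (subset_trans (subsetDl _ _) _).
  by rewrite subUset !circuit_ground.
have eX : e \in cl X.
  apply: subsetP (clS _) _ (circuit_cl DM eD); apply/subsetP => z.
  rewrite !inE => /andP[ze zD]; rewrite ze zD orbT !andbT.
  by apply: contraNneq fD => <-.
have fX : f \in cl X.
  apply: subsetP (cl_min _) _ (circuit_cl CM fC); apply/subsetP => z.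
  have [->|ze] := eqVneq z e; first by rewrite eX.
  case/setD1P => zf zC; apply: (subsetP (sub_cl XE)).
  by rewrite !inE zf ze zC.
have [|K [KM fK KX]] := cl_circuit fX; first by rewrite !inE eqxx.
exists K; split=> //; apply: subset_trans KX _.
by rewrite subUset sub1set !inE fe fC subsetDl.
Qed.

(** Transitivity of sharing a circuit, by induction on the size of the union. Eliminating [e] gives
    [K] through [x] and [L] through [y]. Either [K :|: D] is smaller, or [K] contains [C :\: D],
    hence meets [L], and [K :|: L] misses [e]. *)
Lemma circuit_join C D x y : C \in circuits M -> D \in circuits M ->
    x \in C -> y \in D -> C :&: D != set0 ->
  exists2 K, K \in circuits M & (x \in K) && (y \in K).
Proof.
have [n] := ubnP #|C :|: D|; elim: n C D => // n IH C D /ltnSE leCD CM DM xC yD.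
case/set0Pn => e /setIP[eC eD].
have [xD|xD] := boolP (x \in D); first by exists D; rewrite ?xD.
have [yC|yC] := boolP (y \in C); first by exists C; rewrite ?xC.
have [K [KM xK KCD]] := strong_elimination CM DM eC eD xC xD.
have [L [LM yL LCD]] := strong_elimination DM CM eD eC yD yC.
rewrite setUC in LCD.
have meets (K' C' D' : {set T}) : K' \in circuits M -> C' \in circuits M ->
    K' \subset (C' :|: D') :\ e -> e \in C' -> exists2 z, z \in K' & z \in D' :\: C'.
  move=> KM' CM' sK eC'; have /subsetPn[z zK zC] : ~~ (K' \subset C').
    apply/negP => /(circuit_eq CM' KM') eqK; move: sK; rewrite eqK.
    by move/subsetP/(_ e eC'); rewrite !inE eqxx.
  exists z => //; rewrite inE zC; move/subsetP: sK => /(_ z zK).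
  by rewrite !inE (negPf zC) => /andP[].
have [u uK /setDP[uD uC]] := meets _ _ _ KM CM KCD eC.
have LDC : L \subset (D :|: C) :\ e by rewrite setUC.
have [v vL /setDP[vC vD]] := meets _ _ _ LM DM LDC eD.
have [ltK|geK] := ltnP #|K :|: D| #|C :|: D|.
  apply: (IH K D) => //; first exact: leq_trans ltK leCD.
  by apply/set0Pn; exists u; rewrite inE uK.
have vK : v \in K.
  have /eqP/setP/(_ v) : K :|: D == C :|: D.
    rewrite eqEcard geK andbT subUset subsetUr andbT.
    by rewrite (subset_trans KCD) ?subsetDl.
  by rewrite !inE vC (negPf vD) orbF.
apply: (IH K L) => //; last by apply/set0Pn; exists v; rewrite inE vK.
apply: leq_trans leCD; apply: proper_card; apply/properP.
split; first by rewrite subUset (subset_trans KCD) ?(subset_trans LCD) ?subsetDl.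
exists e; rewrite !inE ?eC //; apply/norP; split; apply/negP => h.
  by move/subsetP: KCD => /(_ e h); rewrite !inE eqxx.
by move/subsetP: LCD => /(_ e h); rewrite !inE eqxx.
Qed.

Lemma same_component_equiv : {in E & &, equivalence_rel (same_component M)}.
Proof.
have sc_sym x y : same_component M x y = same_component M y x.
  rewrite /same_component eq_sym; congr (_ || _).
  by apply/exists_inP/exists_inP => -[C CM]; rewrite andbC; exists C.
have sc_tr x y z : same_component M x y -> same_component M y z -> same_component M x z.
  case/predU1P => [->//|/exists_inP[C CM /andP[xC yC]]].
  case/predU1P => [<-|/exists_inP[D DM /andP[yD zD]]].
    by apply/orP; right; apply/exists_inP; exists C; rewrite ?xC.
  have [|K KM xzK] := circuit_join CM DM xC zD.
    by apply/set0Pn; exists y; rewrite inE yC.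
  by apply/orP; right; apply/exists_inP; exists K.
move=> x y z _ _ _; split=> [|xy]; first by rewrite /same_component eqxx.
by apply/idP/idP; apply: sc_tr; rewrite // sc_sym.
Qed.

Lemma component_circuit C X : X \in connected_components M -> C \in circuits M ->
  C :&: X != set0 -> C \subset X.
Proof.
move=> XM CM /set0Pn[x /setIP[xC xX]].
have CE := circuit_ground CM; have xE := subsetP CE _ xC.
have /and3P[_ tP _] := equivalence_partitionP same_component_equiv.
have eqX : pblock (connected_components M) x = X by apply: def_pblock.
apply/subsetP => y yC; rewrite -eqX.
rewrite (pblock_equivalence_partition same_component_equiv) ?(subsetP CE) //.
by apply/orP; right; apply/exists_inP; exists C; rewrite ?xC.
Qed.

Lemma component_sub X : X \in connected_components M -> X \subset E.
Proof. by case/imsetP => x _ ->; apply/subsetP => y; rewrite inE => /andP[]. Qed.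

Lemma component_connected X x y : X \in connected_components M ->
  x \in X -> y \in X -> same_component M x y.
Proof.
move=> XM xX yX; have XE := component_sub XM.
have /and3P[_ tP _] := equivalence_partitionP same_component_equiv.
have eqX : pblock (connected_components M) x = X by apply: def_pblock.
rewrite -(pblock_equivalence_partition same_component_equiv) ?(subsetP XE) //.
by rewrite -/(connected_components M) eqX.
Qed.

Lemma ex_component x : x \in E -> exists2 X, X \in connected_components M & x \in X.
Proof.
have /and3P[/eqP cov _ _] := equivalence_partitionP same_component_equiv.
by rewrite -{1}cov => /bigcupP[X]; exists X.
Qed.

Definition separator X := rk X + rk (E :\: X) == rk E.

(** A basis of [X] and one of its complement have an independent union, since a circuit in it would
    lie on one side. *)
Lemma component_separator X : X \in connected_components M -> separator X.
Proof.
move=> XM; rewrite /separator eqn_leq andbC.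
rewrite -{1}(setID E X) (setIidPr (component_sub XM)) rkU /=.
have [I [IM IX <-]] := rk_witness X; have [J [JM JX <-]] := rk_witness (E :\: X).
have dIX : [disjoint J & X] by move: JX; rewrite subsetD => /andP[].
have dIJ : [disjoint I & J] by rewrite disjoint_sym; apply: disjointWr IX _.
have /eqP<- : #|I :|: J| == #|I| + #|J| by rewrite (leq_card_setU I J).2.
have IJE : I :|: J \subset E by rewrite subUset !indep_ground.
apply: rk_ge => //; apply/negPn/negP => /(dep_circuit IJE)[C CM CIJ].
have [_ nC _] := circuitP _ CM; case/negP: nC.
have [/(component_circuit XM CM) CX|] := boolP (C :&: X != set0).
  apply: indep_sub IM _; apply/subsetP => x xC.
  have := subsetP CIJ x xC; rewrite inE => /orP[//|xJ].
  by have := disjointFr dIX xJ; rewrite (subsetP CX).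
rewrite negbK setI_eq0 => dCX; apply: indep_sub JM _; apply/subsetP => x xC.
have := subsetP CIJ x xC; rewrite inE => /orP[xI|//].
by have := disjointFr dCX xC; rewrite (subsetP IX).
Qed.

Lemma separator_rk X Z : X \subset E -> separator X -> rk Z = rk (Z :&: X) + rk (Z :\: X).
Proof.
move=> XE /eqP sepX; apply/eqP; rewrite eqn_leq -{1}(setID Z X) rkU /=.
have h1 := rk_submod X Z.
have h2 := rk_submod (X :|: Z) (E :\: X).
have e1 : rk (X :|: Z :|: E :\: X) = rk E.
  rewrite -rk_ground; congr (rk _); apply/setP => z; rewrite !inE.
  by case: (z \in E); rewrite ?andbF // !andbT orbC orbA orNb.
have e2 : rk ((X :|: Z) :&: (E :\: X)) = rk (Z :\: X).
  rewrite -[RHS]rk_ground; congr (rk _); apply/setP => z; rewrite !inE.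
  by case: (z \in X); case: (z \in E); rewrite ?andbF ?andbT.
rewrite setIC in h1; lia.
Qed.

Lemma separator_circuit C X : X \subset E -> separator X -> C \in circuits M ->
  C :&: X != set0 -> C \subset X.
Proof.
move=> XE sepX CM /set0Pn[x /setIP[xC xX]]; apply/subsetP => y yC.
apply/negPn/negP => yX; have [_ _ minC] := circuitP _ CM.
have IX : C :&: X \in indep M.
  apply: indep_sub (minC y yC) _; rewrite subsetD1 subsetIl inE (negPf yX).
  by rewrite andbF.
have ID : C :\: X \in indep M.
  by apply: indep_sub (minC x xC) _; rewrite subsetD1 subsetDl inE xX.
have := separator_rk C XE sepX; rewrite (rk_indep IX) (rk_indep ID) cardsID => eqC.
by have := circuit_rk CM; rewrite eqC => /eqP; rewrite eqn_leq ltnn.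
Qed.

End RankClosure.

(** * Rank in the dual *)

Section DualRank.
Variables (T : finType) (M : matroid T).
Implicit Types (I J B C D X Y Z : {set T}) (x y z : T).

Local Notation E := (ground M).

Lemma basisP B : reflect (B \in indep M /\ #|B| = rk M E) (B \in bases M).
Proof.
rewrite inE; apply: (iffP maxsetP) => /= [[BM maxB]|[BM cB]].
  split=> //; have [K [KM BK _ <-]] := rk_extend BM (indep_ground BM).
  by rewrite (maxB K).
split=> // K KM BK; apply/esym/eqP; rewrite eqEcard BK cB.
by rewrite rk_ge ?indep_ground.
Qed.

Lemma dual_indepP I : I \subset E -> (I \in indep (dual M)) = (rk M (E :\: I) == rk M E).
Proof.
move=> IE; rewrite inE; apply/exists_inP/eqP => [[B /basisP[BM cB] IB]|eqr].
  apply/eqP; rewrite eqn_leq rkS ?subsetDl //= -cB rk_ge // subsetD indep_ground //=.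
  by move: IB; rewrite subsetD disjoint_sym => /andP[].
have [B [BM BI cB]] := rk_witness M (E :\: I).
exists B; first by apply/basisP; rewrite cB.
by move: BI; rewrite !subsetD IE disjoint_sym => /andP[].
Qed.

(** The bound is attained by [X :\: B], where the basis [B] extends a basis of the complement of
    [X]. *)
Lemma rk_dual X : X \subset E -> rk (dual M) X + rk M E = #|X| + rk M (E :\: X).
Proof.
move=> XE; apply/eqP; rewrite eqn_leq; apply/andP; split.
  have [I [IM IX <-]] := rk_witness (dual M) X.
  have IE := subset_trans IX XE.
  move: IM; rewrite dual_indepP // => /eqP <-.
  have -> : #|X| = #|I| + #|X :\: I| by rewrite -(cardsID I X) (setIidPr IX).
  rewrite -addnA leq_add2l; apply: leq_trans (leq_add (rk_card M _) (leqnn _)).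
  apply: leq_trans (rkU _ _ _); apply: rkS; apply/subsetP => z; rewrite !inE.
  by case: (z \in X); rewrite ?andbT ?orbT // => /andP[-> ->].
have [J [JM JX <-]] := rk_witness M (E :\: X).
have [B [BM JB BE cB]] := rk_extend JM (indep_ground JM).
have XB : X :\: B \in indep (dual M).
  rewrite dual_indepP ?(subset_trans (subsetDl _ _)) //.
  rewrite eqn_leq rkS ?subsetDl //= -cB rk_ge // subsetD BE /= -setI_eq0.
  by rewrite setIDA setDIl setDv set0I.
apply: leq_trans (leq_add (rk_ge XB (subsetDl _ _)) (leqnn _)).
have JBX : #|J| <= #|B :\: X|.
  apply: subset_leq_card; rewrite subsetD JB /=.
  by move: JX; rewrite subsetD => /andP[].
have := cardsID B X; have := cardsID X B; rewrite setIC -cB; lia.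
Qed.

End DualRank.

(** * Capturing circuits by laminar families *)

Section Restrict.
Variable T : finType.
Implicit Types (M N : matroid T) (I C D F X Y Z : {set T}) (A : {set {set T}}).

(** Phrased through ranks so as to serve both a restriction and the dual of a restriction to a
    separator. *)
Lemma circuits_eq_rk M N X : ground N = X -> X \subset ground M ->
    (forall Z, Z \subset X -> rk N Z = rk M Z) ->
  forall C, (C \in circuits N) = (C \in circuits M) && (C \subset X).
Proof.
move=> gN XM eqr C.
have eqI I : I \subset X -> (I \in indep N) = (I \in indep M).
  by move=> IX; apply/idP/idP => /rk_indep eqc; apply: indep_rk;
    rewrite ?eqr -?eqc ?eqr // -eqr // eqc.
apply/circuitP/andP => [[]|[/circuitP[_ nC minC] CX]]; rewrite gN.
  move=> CX nC minC; split=> //; apply/circuitP.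
  split=> [||x xC]; first exact: subset_trans CX XM; first by rewrite -eqI.
  by rewrite -eqI ?minC // (subset_trans (subsetDl _ _)).
split=> // [|x xC]; first by rewrite eqI.
by rewrite eqI ?minC // (subset_trans (subsetDl _ _)).
Qed.

Lemma restriction_ground M X : X \subset ground M -> ground (restriction M X) = X.
Proof. exact: setIidPr. Qed.

Lemma rk_restriction M X Z : Z \subset X -> rk (restriction M X) Z = rk M Z.
Proof.
move=> ZX; apply: eq_bigl => I; rewrite !inE -andbA; congr (_ && _).
by rewrite andb_idl // => /subset_trans; apply.
Qed.

Lemma restriction_circuits M X C : X \subset ground M ->
  (C \in circuits (restriction M X)) = (C \in circuits M) && (C \subset X).
Proof.
move=> XE; apply: circuits_eq_rk => //; first exact: restriction_ground.
exact: rk_restriction.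
Qed.

(** In the two corank formulas the complement of [X] adds the same amount to both sides. *)
Lemma rk_dual_restriction M X Z : X \subset ground M -> separator M X ->
  Z \subset X -> rk (dual (restriction M X)) Z = rk (dual M) Z.
Proof.
move=> XE /[dup] sepX /eqP sX ZX.
have gX := restriction_ground XE.
have := @rk_dual _ (restriction M X) Z; rewrite gX => /(_ ZX).
rewrite !rk_restriction ?subsetDl //.
have := rk_dual (subset_trans ZX XE); rewrite (separator_rk (ground M :\: Z) XE sepX).
have -> : (ground M :\: Z) :&: X = X :\: Z by rewrite setIDAC (setIidPr XE).
rewrite setDDl (setUidPr ZX) -sX; lia.
Qed.

Lemma dual_restriction_circuits M X C : X \subset ground M -> separator M X ->
  (C \in circuits (dual (restriction M X))) = (C \in circuits (dual M)) && (C \subset X).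
Proof.
move=> XE sepX; apply: circuits_eq_rk => //; first exact: restriction_ground.
by move=> Z; apply: rk_dual_restriction.
Qed.

(** Components are defined by the circuits of M; the rank identity lets them separate the cocircuits
    too. *)
Lemma dual_separator M X : X \subset ground M -> separator M X -> separator (dual M) X.
Proof.
rewrite /separator => XE /eqP sX /=.
have h1 := rk_dual XE; have h2 := rk_dual (subsetDl (ground M) X).
have h3 := rk_dual (subxx (ground M)); rewrite setDv rk0 in h3.
rewrite setDDr setDv set0U (setIidPr XE) in h2.
have := cardsID X (ground M); rewrite (setIidPr XE) => h4.
by apply/eqP; move: sX; lia.
Qed.

Definition captures M A C := exists2 F, F \in A & C \subset F /\ rk M F < #|C|.

(** Containment is automatic: if [C] left [F], its trace on [F] would be a proper subset, hence
    independent and of size at most the rank of [F]. *)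
Lemma capturesI M A C F : C \in circuits M -> F \in A -> rk M F < #|C :&: F| ->
  captures M A C.
Proof.
move=> CM FA ltF; exists F => //.
have CF : C \subset F; last by rewrite (setIidPl CF) in ltF.
apply/subsetP => x xC; apply: contraLR ltF => xF; rewrite -leqNgt.
have [_ _ minC] := circuitP _ _ CM.
apply: rk_ge (subsetIr _ _); apply: indep_sub (minC x xC) _.
by rewrite subsetD1 subsetIl inE (negPf xF) andbF.
Qed.

Definition laminar_capture M := exists2 A, laminar_family (ground M) A
  & forall C, C \in circuits M -> captures M A C.

Lemma laminar_of_capture M : laminar_capture M -> laminar M.
Proof.
case=> A lamA capA; exists T, (ground M), A, (rk M), lamA.
exists id; first by exists id.
move=> I; set J := [set val x | x in I].
have JE : J \subset ground M by apply/subsetP => _ /imsetP[x _ ->]; apply: valP.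
rewrite inE JE /=; apply/idP/forall_inP => [JM F FA|h].
  by rewrite rk_ge ?subsetIr // (indep_sub JM) ?subsetIl.
apply/negPn/negP => /(dep_circuit JE)[C /capA[F FA [CF ltF]] CJ].
move: ltF; rewrite ltnNge => /negP[].
apply: leq_trans (h F FA); apply: subset_leq_card; rewrite subsetI.
by rewrite CJ CF.
Qed.

(** The family is pulled back along the isomorphism by [psi]. A circuit breaks some capacity [c X],
    while the rank of [psi X] is at most [c X], as independent sets respect it. *)
Lemma capture_of_laminar M : laminar M -> laminar_capture M.
Proof.
case=> [U [E [A [c [[AE lamA] [f /bij_inj f_inj eqI]]]]]].
pose psi (X : {set U}) := [set val x | x : {x | x \in ground M} & val (f x) \in X].
have cardI (I' : {set {x | x \in ground M}}) (X : {set U}) :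
    #|[set val x | x in I'] :&: psi X| = #|[set val (f x) | x in I'] :&: X|.
  transitivity #|[set x in I' | val (f x) \in X]|.
    rewrite -(card_imset _ val_inj); congr #|pred_of_set _|; apply/setP => z.
    apply/setIP/imsetP => [[/imsetP[x xI ->] /imsetP[y]]|[x]].
      by rewrite inE => yX /val_inj eqxy; exists x; rewrite // inE xI eqxy.
    rewrite inE => /andP[xI xX] ->; split; first exact: imset_f.
    by apply: imset_f; rewrite inE.
  rewrite -(card_imset _ (inj_comp val_inj f_inj)); congr #|pred_of_set _|.
  apply/setP => z; apply/imsetP/setIP => [[x]|[/imsetP[x xI ->] xX]].
    by rewrite inE => /andP[xI xX] ->; split; first exact: (imset_f (val \o f)).
  by exists x; rewrite // inE xI.
have rep I : I \subset ground M ->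
    (I \in indep M) = [forall X in A, #|I :&: psi X| <= c X].
  move=> IM.
  have eqII : I = [set val x | x in [set x : {x | x \in ground M} | val x \in I]].
    apply/setP => z; apply/idP/imsetP => [zI|[x]]; last by rewrite inE => xI ->.
    by exists (Sub z (subsetP IM z zI)); rewrite ?inE SubK.
  rewrite eqII eqI inE [_ \subset E](_ : _ = true); last first.
    by apply/subsetP => _ /imsetP[x _ ->]; apply: (valP (f x)).
  by apply: eq_forallb_in => X XA; rewrite cardI.
exists [set psi X | X in A].
  split=> [_ /imsetP[X _ ->]|_ _ /imsetP[X XA ->] /imsetP[Y YA ->]].
    by apply/subsetP => _ /imsetP[x _ ->]; apply: valP.
  case/set0Pn => z /setIP[/imsetP[x]]; rewrite inE => xX ->.
  case/imsetP => y; rewrite inE => yY /val_inj eqxy.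
  have [|s|s] := lamA X Y XA YA.
  - by apply/set0Pn; exists (val (f x)); rewrite inE xX eqxy.
  - by left; apply: imsetS; apply/subsetP => u; rewrite !inE; apply: (subsetP s).
  - by right; apply: imsetS; apply/subsetP => u; rewrite !inE; apply: (subsetP s).
move=> C CM; have [CE nC _] := circuitP _ _ CM.
move: nC; rewrite rep // => /forall_inPn[X XA]; rewrite -ltnNge => ltX.
apply: capturesI CM (imset_f _ XA) _; apply: leq_ltn_trans ltX.
have [I [IM IX <-]] := rk_witness M (psi X).
move: (IM); rewrite rep ?indep_ground // => /forall_inP/(_ X XA).
by rewrite (setIidPl IX).
Qed.

Lemma laminar_capture_glue M (P : {set {set T}}) :
    trivIset P -> (forall X, X \in P -> X \subset ground M) ->
    (forall C, C \in circuits M -> exists2 X, X \in P & C \subset X) ->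
    (forall X, X \in P -> exists2 A, laminar_family X A &
       forall C, C \in circuits M -> C \subset X -> captures M A C) ->
  laminar_capture M.
Proof.
move=> /trivIsetP tP PE PC PA.
(* Membership in [P] sits under the existential so that [fin_all_exists] can choose a family for
   every set [X]. *)
have ex X : exists A, X \in P -> laminar_family X A /\
       (forall C, C \in circuits M -> C \subset X -> captures M A C).
  have [XP|] := boolP (X \in P); last by exists set0.
  by have [A] := PA X XP; exists A.
have [A {}PA] := fin_all_exists ex.
exists (\bigcup_(X in P) A X).
  split=> [F /bigcupP[X XP FA]|F G /bigcupP[X XP FA] /bigcupP[Y YP GA] ne].
    by apply: subset_trans (PE X XP); apply: (PA X XP).1.1.
  have eqXY : X = Y.
    apply/eqP; apply: contraNT ne => /(tP X Y XP YP); rewrite setI_eq0.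
    move=> dXY; apply: disjointWl ((PA X XP).1.1 F FA) _.
    exact: disjointWr ((PA Y YP).1.1 G GA) dXY.
  by rewrite eqXY in FA; apply: (PA Y YP).1.2.
move=> C CM; have [X XP CX] := PC C CM; have [F FA CF] := (PA X XP).2 C CM CX.
by exists F => //; apply/bigcupP; exists X.
Qed.

Definition cl_comparable M C D := (C \subset cl M D) || (D \subset cl M C).

Definition laminar_circuits M := forall C D, C \in circuits M -> D \in circuits M ->
  C :&: D != set0 -> cl_comparable M C D.

(** A circuit spans the set that captures it. If [F] captures [C], [G] captures [D] and [F] lies in
    [G], then [C] lies in [G], hence in the closure of [D]. *)
Lemma laminar_capture_circuits M : laminar_capture M -> laminar_circuits M.
Proof.
case=> A [AE lamA] capA C D CM DM /set0Pn[x /setIP[xC xD]].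
have [F FA [CF ltF]] := capA C CM; have [G GA [DG ltG]] := capA D DM.
have key (C' D' F' G' : {set T}) :
    C' \in circuits M -> D' \in circuits M -> F' \subset G' -> C' \subset F' -> D' \subset G' -> rk M G' < #|D'| -> C' \subset cl M D'.
  move=> CM' DM' FG CF' DG'; rewrite -(circuit_rk DM') ltnS => leG.
  apply/sub_clP; split; first exact: circuit_ground.
  apply/eqP; rewrite eqn_leq [_ <= rk _ (_ :|: _)]rkS ?subsetUl // andbT.
  by apply: leq_trans leG; rewrite rkS // subUset DG' (subset_trans CF').
have [|s|s] := lamA F G FA GA.
- by apply/set0Pn; exists x; rewrite inE (subsetP CF) ?(subsetP DG).
- by rewrite /cl_comparable (key C D F G).
- by rewrite /cl_comparable orbC (key D C G F).
Qed.

Lemma cl_eq_rk M N X D : ground N = X -> X \subset ground M ->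
    (forall Z, Z \subset X -> rk N Z = rk M Z) ->
  D \subset X -> cl N D = cl M D :&: X.
Proof.
move=> gN XM eqr DX; apply/setP => x; rewrite !inE gN.
have [xX|] := boolP (x \in X); last by rewrite andbF.
by rewrite (subsetP XM) //= !eqr ?andbT // subUset sub1set xX.
Qed.

Lemma laminar_circuits_eq_rk M N X : ground N = X -> X \subset ground M ->
    (forall Z, Z \subset X -> rk N Z = rk M Z) ->
  laminar_circuits M -> laminar_circuits N.
Proof.
move=> gN XM eqr sM C D; rewrite !(circuits_eq_rk gN XM eqr).
move=> /andP[CM CX] /andP[DM DX] /sM; rewrite /cl_comparable.
by rewrite !(cl_eq_rk gN XM eqr) // !subsetI CX DX !andbT; apply.
Qed.

End Restrict.

(** * From the components to the matroid *)

Section Families.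
Variable T : finType.
Implicit Types (M N U V : matroid T) (I J C D F G H X Y Z : {set T}) (A : {set {set T}}).

(* If J is a basis of the complement of a cocircuit D, the largest member F   *)
(* of A with [rk F <= #|J :&: F|] absorbs every element of [~: D] outside J,  *)
(* and this forces D to violate the dual rank bound of the complement of F.   *)
Lemma dual_captures N A :
    (forall F, F \in A -> F \subset ground N) -> set0 \in A ->
    (forall C, C \in circuits N -> captures N A C) ->
    (forall J F G, J \in indep N -> F \in A -> G \in A ->
       rk N F <= #|J :&: F| -> rk N G <= #|J :&: G| ->
       exists2 H, H \in A & F :|: G \subset H /\ rk N H <= #|J :&: H|) ->
  forall D, D \in circuits (dual N) ->
    captures (dual N) [set ground N :\: F | F in A] D.
Proof.
move=> AE A0 capA dirA D DM; have [/= DE nD _] := circuitP _ _ DM.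
have [J [JN JD cJ]] := rk_witness N (ground N :\: D).
have ltJ : #|J| < rk N (ground N).
  by rewrite cJ ltn_neqAle -dual_indepP // nD rkS ?subsetDl.
pose tight := [pred F in A | rk N F <= #|J :&: F|].
have t0 : tight set0 by rewrite /= A0 rk0.
have [F /maxsetP[/= /andP[FA tF] maxF] _] := maxset_exists t0.
have DJF : ground N :\: D :\: F \subset J.
  apply/subsetP => z /setDP[zED zF]; apply: contraR zF => zJ.
  have [zE zD] := setDP zED.
  have nzJ : z |: J \notin indep N.
    apply/negP => /rk_ge/(_ (_ : _ \subset ground N :\: D)).
    by rewrite -cJ cardsU1 zJ ltnn subUset sub1set zED JD; move/(_ isT).
  have [|C CN CJ] := dep_circuit _ nzJ; first by rewrite subUset sub1set zE indep_ground.
  have zC : z \in C.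
    have [_ nC _] := circuitP _ _ CN; apply: contraR nC => zC.
    apply: indep_sub JN _; apply/subsetP => y yC.
    by case/setU1P: (subsetP CJ y yC) => // eqy; rewrite -eqy yC in zC.
  have [G GA [CG ltG]] := capA C CN.
  have tG : rk N G <= #|J :&: G|.
    rewrite -ltnS; apply: leq_trans ltG _; rewrite (cardsD1 z) zC add1n ltnS.
    apply: subset_leq_card; apply/subsetP => y /setD1P[yz yC].
    rewrite inE (subsetP CG) // andbT.
    by case/setU1P: (subsetP CJ y yC) => // eqy; rewrite eqy eqxx in yz.
  have [H HA [FGH tH]] := dirA J F G JN FA GA tF tG.
  have <- : H = F by apply: maxF; rewrite ?HA //; apply: subset_trans (subsetUl _ _) FGH.
  by apply: (subsetP FGH); rewrite inE (subsetP CG) ?orbT.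
apply: capturesI DM (imset_f _ FA) _.
(* As [rk N F <= #|J :&: F|] and [#|J| < rk N (ground N)], the corank of the complement of [F] is
   below its size minus [#|J :\: F|]; by [DJF], [D] misses at most [#|J :\: F|] of its elements. *)
have := rk_dual (subsetDl (ground N) F); rewrite setDDr setDv set0U (setIidPr (AE F FA)).
have := cardsID D (ground N :\: F).
have -> : (ground N :\: F) :&: D = D :&: (ground N :\: F) by rewrite setIC.
have -> : ground N :\: F :\: D = ground N :\: D :\: F by rewrite !setDDl setUC.
have : #|ground N :\: D :\: F| <= #|J :\: F|.
  by apply: subset_leq_card; rewrite subsetD DJF -setI_eq0 setIDAC setDIl setDv setI0 eqxx.
have := cardsID F J; lia.
Qed.

Lemma laminar_capture_dual N A :
    laminar_family (ground N) A ->
    laminar_family (ground N) [set ground N :\: F | F in A] ->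
    set0 \in A ->
    (forall C, C \in circuits N -> captures N A C) ->
    (forall J F G, J \in indep N -> F \in A -> G \in A ->
       rk N F <= #|J :&: F| -> rk N G <= #|J :&: G| ->
       exists2 H, H \in A & F :|: G \subset H /\ rk N H <= #|J :&: H|) ->
  laminar_capture N /\ laminar_capture (dual N).
Proof.
move=> lamA lamA' A0 capA dirA; split; first by exists A.
by exists [set ground N :\: F | F in A] => //; apply: dual_captures => // F; apply: lamA.1.
Qed.

(** Hall's condition for a chain: elements outside the set of index [j - 1] must use one of the
    [size B - j] indices from [j] on; prefixing [set0] makes [j = 0] the bound on [#|I|].
    Conversely, walk up the chain and give each index to one unassigned element of its set, if there
    is any. *)
Lemma partial_transversalP (B : seq {set T}) I :
    sorted (fun X Y : {set T} => X \subset Y) B ->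
  partial_transversal B I <->
    (forall j, j <= size B -> #|I :\: nth set0 (set0 :: B) j| <= size B - j).
Proof.
move=> sB; split=> [[phi phi_inj Bphi] j jB|].
  set S := I :\: _.
  have uS : uniq (map phi (enum S)).
    rewrite map_inj_in_uniq ?enum_uniq // => x y; rewrite !mem_enum.
    by move=> /setDP[xI _] /setDP[yI _]; apply: phi_inj.
  rewrite -(size_iota j (size B - j)) cardE -(size_map phi).
  apply: uniq_leq_size => // _ /mapP[x xS ->]; move: xS; rewrite mem_enum.
  case/setDP => xI xB; have xphi := Bphi x xI.
  have ltphi : phi x < size B.
    by rewrite ltnNge; apply/negP => /(nth_default set0) eq0; rewrite eq0 inE in xphi.
  rewrite mem_iota subnKC // ltphi andbT leqNgt; apply/negP => ltj.
  case: j jB ltj @S uS xB => // j jB; rewrite ltnS => ltj S uS /negP[] /=.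
  have tr : transitive (fun X Y : {set T} => X \subset Y).
    by move=> Y X Z; apply: subset_trans.
  have := sorted_leq_nth tr (@subxx _ _) set0 sB.
  by move=> /(_ (phi x) j ltphi jB ltj)/subsetP; apply.
elim: B I {sB} => [|X B IH] I h.
  have := h 0 isT; rewrite /= setD0 leqn0 cards_eq0 => /eqP->.
  by exists (fun=> 0) => [x y|x]; rewrite inE.
have [IX0|[x0 /setIP[x0I x0X]]] := set_0Vmem (I :&: X).
  have [|phi phi_inj Bphi] := IH I.
    case=> [|j] jB; last by have := h j.+2 jB.
    have := h 1 isT; rewrite /= subSS subn0 setD0; congr (#|pred_of_set _| <= _).
    by apply/setDidPl; rewrite -setI_eq0 IX0.
  exists (S \o phi) => [x y xI yI []|x xI]; first exact: phi_inj.
  exact: Bphi.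
have [|phi phi_inj Bphi] := IH (I :\ x0).
  case=> [|j] jB.
    by have := h 0 isT; rewrite /= !subn0 !setD0 (cardsD1 x0) x0I.
  have := h j.+2 jB; rewrite subSS; apply: leq_trans.
  by apply: subset_leq_card; apply: setSD; apply: subsetDl.
exists (fun x => if x == x0 then 0 else (phi x).+1) => [x y xI yI|x xI].
  case: eqVneq => [->|xx0]; case: eqVneq => [->|yx0] // [] /phi_inj; apply.
    by rewrite !inE xx0.
  by rewrite !inE yx0.
by case: eqVneq => [->|xx0] //=; apply: Bphi; rewrite !inE xx0.
Qed.

Lemma chain_laminar X A : (forall F, F \in A -> F \subset X) ->
    (forall F G, F \in A -> G \in A -> F \subset G \/ G \subset F) ->
  laminar_family X A.
Proof. by move=> AX ch; split=> // F G FA GA _; apply: ch. Qed.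

Lemma nested_capture N : nested N -> laminar_capture N /\ laminar_capture (dual N).
Proof.
case=> B [/allP BE pB] sB.
pose b j := nth set0 (set0 :: B) j.
have tr : transitive (fun X Y : {set T} => X \subset Y).
  by move=> Y X Z; apply: subset_trans.
have bS i j : i <= j -> j < (size B).+1 -> b i \subset b j.
  move=> ij jB; apply: (sorted_leq_nth tr (@subxx _ _) set0 (s := set0 :: B)) => //.
  - by case: (B) sB => //= X B' ->; rewrite sub0set.
  - by rewrite inE /=; apply: leq_ltn_trans jB.
(* The Hall bound at [j] limits the trace of [I] on the complement of [b j]; [set0] supplies a tight
   set to start from. *)
pose A := set0 |: [set ground N :\: b j | j : 'I_(size B).+1].
have ch F G : F \in A -> G \in A -> F \subset G \/ G \subset F.
  case/setU1P => [->|/imsetP[i _ ->]]; first by rewrite sub0set; left.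
  case/setU1P => [->|/imsetP[j _ ->]]; first by rewrite sub0set; right.
  by case/orP: (leq_total i j) => le; [right | left]; apply: setDS; apply: bS.
have AE F : F \in A -> F \subset ground N.
  by case/setU1P => [->|/imsetP[i _ ->]]; rewrite ?sub0set ?subsetDl.
apply: (@laminar_capture_dual N A).
- exact: chain_laminar.
- apply: chain_laminar => [_ /imsetP[F _ ->]|]; first exact: subsetDl.
  move=> _ _ /imsetP[F FA ->] /imsetP[G GA ->].
  by have [s|s] := ch F G FA GA; [right | left]; apply: setDS.
- exact: setU11.
- move=> C CN; have [CE nC _] := circuitP _ _ CN.
  have [j ltj] : exists j : 'I_(size B).+1, size B - j < #|C :\: b j|.
    apply/existsP; apply: contraR nC => /existsPn h; apply/pB/partial_transversalP => // j jB.
    by have := h (Ordinal (jB : j < (size B).+1)); rewrite -leqNgt.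
  apply: (@capturesI _ _ _ _ (ground N :\: b j)) => //.
    by apply/setU1P; right; apply: imset_f.
  rewrite setIDA (setIidPl CE); apply: leq_ltn_trans ltj.
  have [I [IN]] := rk_witness N (ground N :\: b j); rewrite subsetD => /andP[_ dI] <-.
  have /partial_transversalP-/(_ sB j) := (pB I).1 IN.
  by rewrite -/(b j) (setDidPl dI); apply; rewrite -ltnS.
- move=> J F G JN FA GA tF tG; have [s|s] := ch F G FA GA.
    by exists G => //; rewrite (setUidPr s).
  by exists F => //; rewrite (setUidPl s).
Qed.

(** [X], [Y] and [X :|: Y] carry the bounds [k], [l] and [r]. With [set0] they are closed under
    complement. If [X] and [Y] are both tight, so is their union, since they are disjoint. *)
Lemma truncated_sum_capture N :
  truncated_sum_of_two_uniform N -> laminar_capture N /\ laminar_capture (dual N).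
Proof.
case=> U [V [dUV [r [[[k _ iU] _] [[l _ iV] _] _ ->]]]].
set X := ground U; set Y := ground V; set N' := truncation r _.
have XY0 : X :&: Y = set0 by apply/eqP; rewrite setI_eq0.
have YX0 : Y :&: X = set0 by rewrite setIC.
have indepP I : I \subset X :|: Y ->
    (I \in indep N') = [&& #|I :&: X| <= k, #|I :&: Y| <= l & #|I| <= r].
  move=> IE; rewrite inE andbA; congr (_ && _); apply/imset2P/andP.
    case=> I1 I2; rewrite iU iV !inE => /andP[I1X c1] /andP[I2Y c2] ->.
    rewrite !setIUl (setIidPl I1X) (setIidPl I2Y).
    rewrite (_ : I2 :&: X = set0) ?setU0; last first.
      by apply/eqP; rewrite -subset0 -YX0 setSI.
    rewrite (_ : I1 :&: Y = set0) ?set0U //.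
    by apply/eqP; rewrite -subset0 -XY0 setSI.
  case=> c1 c2; exists (I :&: X) (I :&: Y); rewrite ?iU ?iV ?inE ?subsetIr //.
  by rewrite -setIUr (setIidPl IE).
have rkX : rk N' X <= k.
  have [I [IN IX <-]] := rk_witness N' X; have := IN.
  rewrite indepP ?(subset_trans IX) ?subsetUl // => /and3P[+ _ _].
  by rewrite (setIidPl IX).
have rkY : rk N' Y <= l.
  have [I [IN IY <-]] := rk_witness N' Y; have := IN.
  rewrite indepP ?(subset_trans IY) ?subsetUr // => /and3P[_ + _].
  by rewrite (setIidPl IY).
have rkE : rk N' (X :|: Y) <= r.
  have [I [IN IE <-]] := rk_witness N' (X :|: Y); have := IN.
  by rewrite indepP // => /and3P[_ _].
pose A := [set set0; X; Y; X :|: Y].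
have inA F : F \in A -> [\/ F = set0, F = X, F = Y | F = X :|: Y].
  rewrite !inE => /orP[/orP[/orP[]|]|] /eqP->.
  - by constructor 1.
  - by constructor 2.
  - by constructor 3.
  - by constructor 4.
have lamA : laminar_family (X :|: Y) A.
  split=> [F /inA[] ->|F G /inA[] -> /inA[] ->];
    rewrite ?sub0set ?subsetUl ?subsetUr ?subxx ?XY0 ?YX0 ?eqxx //; by [left | right].
apply: (@laminar_capture_dual N' A) => //.
- split=> [_ /imsetP[F _ ->]|]; first exact: subsetDl.
  have cA F : F \in A -> ground N' :\: F \in A.
    rewrite /=; case/inA => ->; rewrite !inE.
    - by rewrite setD0 eqxx !orbT.
    - by rewrite setDUl setDv set0U (setDidPl _) ?eqxx ?orbT // -setI_eq0 YX0.
    - by rewrite setDUl setDv setU0 (setDidPl _) ?eqxx ?orbT // -setI_eq0 XY0.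
    - by rewrite setDv eqxx.
  by move=> _ _ /imsetP[F FA ->] /imsetP[G GA ->]; apply: lamA.2; apply: cA.
- by rewrite !inE eqxx.
- move=> C CN; have [CE nC _] := circuitP _ _ CN; move: nC.
  rewrite indepP // !negb_and -!ltnNge => /or3P[lt|lt|lt].
  + by apply: (@capturesI _ _ _ _ X) (leq_ltn_trans rkX lt); rewrite // !inE eqxx !orbT.
  + by apply: (@capturesI _ _ _ _ Y) (leq_ltn_trans rkY lt); rewrite // !inE eqxx !orbT.
  + apply: (@capturesI _ _ _ _ (X :|: Y)); rewrite // ?inE ?eqxx ?orbT //.
    by rewrite (setIidPl CE) (leq_ltn_trans rkE lt).
have dirXY J : J \in indep N' -> rk N' X <= #|J :&: X| -> rk N' Y <= #|J :&: Y| ->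
    exists2 H, H \in A & X :|: Y \subset H /\ rk N' H <= #|J :&: H|.
  move=> JN tX tY; exists (X :|: Y); first by rewrite !inE eqxx !orbT.
  split=> //; apply: leq_trans (rkU _ _ _) _; apply: leq_trans (leq_add tX tY) _.
  by rewrite setIUr -cardsUI setIACA XY0 setI0 cards0 addn0.
move=> J F G JN FA GA tF tG.
have one H : H \in A -> rk N' H <= #|J :&: H| -> F :|: G = H ->
   exists2 H, H \in A & F :|: G \subset H /\ rk N' H <= #|J :&: H|.
  by move=> HA tH ->; exists H.
case/inA: (FA) => eF; case/inA: (GA) => eG; subst F G;
  try (by apply: dirXY); try (by rewrite setUC; apply: dirXY);
  solve [ apply: (one _ GA tG); apply/setP => z; rewrite !in_setU ?in_set0;
          by case: (z \in X); case: (z \in Y)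
        | apply: (one _ FA tF); apply/setP => z; rewrite !in_setU ?in_set0;
          by case: (z \in X); case: (z \in Y) ].
Qed.

End Families.

(** * Connected laminar matroids with laminar dual *)

(** Orthogonality: otherwise [C :\ y] puts [y] in the closure of the complement of [D], and
    coindependence of [D :\ y] would extend to [D]. *)
Lemma circuit_cocircuit (T : finType) (N : matroid T) (C D : {set T}) y :
  C \in circuits N -> D \in circuits (dual N) -> C :&: D != [set y].
Proof.
move=> CN DN; apply/eqP => eqCD.
have /setIP[yC yD] : y \in C :&: D by rewrite eqCD set11.
have [/= DE nD minD] := circuitP _ _ DN.
have DyE : D :\ y \subset ground N := subset_trans (subsetDl _ _) DE.
have CD : C :\ y \subset ground N :\: D.
  rewrite subsetD (subset_trans (subsetDl _ _)) ?circuit_ground //=.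
  by rewrite -setI_eq0 setIDAC eqCD setDv.
have /setIdP[_ /eqP eqy] := subsetP (clS N CD) _ (circuit_cl CN yC).
have := minD y yD; rewrite dual_indepP // setDDr (_ : ground N :&: [set y] = [set y]).
  by rewrite setUC eqy -dual_indepP ?(negPf nD).
by apply/setIidPr; rewrite sub1set (subsetP DE).
Qed.

(** * Pairwise comparable circuits give a nested presentation *)

Section AllComparable.
Variables (T : finType) (N : matroid T).
Hypothesis cmp : forall C D, C \in circuits N -> D \in circuits N -> cl_comparable N C D.
Implicit Types C D I : {set T}.

Let W k := \bigcup_(C in [set C in circuits N | rk N C <= k]) C.

(** Among comparable circuits, one of largest rank spans all the others. *)
Lemma rk_low_circuits k : rk N (W k) <= k.
Proof.
have [S0|[C0 C0S]] := set_0Vmem [set C in circuits N | rk N C <= k].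
  by rewrite /W S0 big_set0 rk0.
case: (arg_maxnP (rk N) C0S) => C /setIdP[CN Ck] maxC.
apply: leq_trans Ck; rewrite -[leqRHS]rk_cl; apply: rkS.
apply/bigcupsP => D DS; have := maxC D DS; move: DS; rewrite inE => /andP[DN Dk] leD.
case/orP: (cmp CN DN) => // CD; apply/sub_clP; split; first exact: circuit_ground.
apply/eqP; rewrite eqn_leq [_ <= rk _ (_ :|: _)]rkS ?subsetUl // andbT.
by rewrite setUC rk_clU.
Qed.

(** For [0 < j], the Hall bound reads [#|I :&: W k| <= k] with [k = n - j]. It excludes a circuit of
    rank [k], which has [k + 1] elements, all in [W k]; [j = 0] deals with rank [n]. *)
Lemma nested_of_comparable : nested N.
Proof.
set n := rk N (ground N); pose B := mkseq (fun i => ground N :\: W (n - i.+1)) n.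
have WS i j : i <= j -> W i \subset W j.
  move=> ij; apply/bigcupsP => C; rewrite inE => /andP[CN Ci].
  by apply: bigcup_sup; rewrite inE CN (leq_trans Ci).
have sB : sorted (fun X Y : {set T} => X \subset Y) B.
  apply: homo_sorted (iota_ltn_sorted 0 n) => i j ij.
  by apply: setDS; apply: WS; lia.
have szB : size B = n by rewrite size_mkseq.
have nthB j : j < n -> nth set0 (set0 :: B) j.+1 = ground N :\: W (n - j.+1).
  by move=> jn; rewrite /= nth_mkseq.
exists B => //; split.
  by apply/allP => _ /mapP[i _ ->]; apply: subsetDl.
move=> I; rewrite partial_transversalP // szB; split=> [IN [|j] jn|h].
- by rewrite setD0 subn0 rk_ge // indep_ground.
- rewrite nthB // setDDr; have -> : I :\: ground N = set0.
    by apply/eqP; rewrite setD_eq0 indep_ground.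
  rewrite set0U; apply: leq_trans (rk_low_circuits _).
  by rewrite rk_ge ?subsetIr // (indep_sub IN) ?subsetIl.
have IE : I \subset ground N.
  have := h n (leqnn n); rewrite subnn leqn0 cards_eq0 setD_eq0 => IB.
  apply: subset_trans IB _; case: (n) nthB => [|m] nthB; first exact: sub0set.
  by rewrite nthB ?subsetDl.
apply/negPn/negP => /(dep_circuit IE)[C CN CI].
have kn : rk N C <= n by rewrite rkS ?circuit_ground.
have CW : C \subset W (rk N C) by apply: bigcup_sup; rewrite inE CN leqnn.
suff : #|C| <= rk N C by rewrite -(circuit_rk CN) ltnn.
have := h (n - rk N C) (leq_subr _ _); rewrite subKn //; apply: leq_trans.
apply: subset_leq_card; rewrite subsetD CI /=.
case: (posnP (n - rk N C)) => [->|gt0]; first by rewrite -setI_eq0 setI0.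
rewrite -(prednK gt0) nthB; last by lia.
rewrite (prednK gt0) subKn // disjoint_sym; apply: disjointWr CW _.
by rewrite -setI_eq0 setIDAC setDIl setDv setI0.
Qed.

End AllComparable.

(** * Two incomparable circuits in a connected matroid *)

Section Connected.
Variables (T : finType) (N : matroid T).
Implicit Types (C D K L A P Q X : {set T}) (e f g x y : T).

Local Notation E := (ground N).

Hypothesis lamN : laminar_circuits N.
Hypothesis noloop : forall x, x \in E -> [set x] \in indep N.

Lemma cl_comparable_sym C D : cl_comparable N C D = cl_comparable N D C.
Proof. exact: orbC. Qed.

(** Suppose [f] is outside [D] and the circuits are incomparable. A circuit through [f] inside
    [f |: D] lies in [cl N C], as otherwise it would span [C], and so would [D]. By elimination such
    circuits cover [D], so [D] lies in [cl N C] after all. *)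
Lemma cl_comparable_mem C D f : C \in circuits N -> D \in circuits N ->
  f \in C -> f \in cl N D -> cl_comparable N C D.
Proof.
move=> CN DN fC fD; have [fD'|fD'] := boolP (f \in D).
  by apply: lamN => //; apply/set0Pn; exists f; rewrite inE fC.
apply/negPn/negP => ncmp.
have DE := circuit_ground DN.
have fDcl : f |: D \subset cl N D by rewrite subUset sub1set fD sub_cl.
have key L : L \in circuits N -> f \in L -> L \subset f |: D -> L \subset cl N C.
  move=> LN fL LD; have /orP[CL|//] : cl_comparable N C L.
    by apply: lamN => //; apply/set0Pn; exists f; rewrite inE fC.
  case/negP: ncmp; apply/orP; left; apply: subset_trans CL (cl_min _).
  exact: subset_trans LD fDcl.
have [K [KN fK KD]] := cl_circuit fD fD'.
have [g gK gf] : exists2 g, g \in K & g != f.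
  apply/exists_inP; apply: contraT => /exists_inPn h.
  have [_ nK _] := circuitP _ _ KN; case/negP: nK.
  apply: indep_sub (noloop (subsetP (circuit_ground CN) f fC)) _.
  by apply/subsetP => g /h; rewrite negbK inE.
have gD : g \in D by case/setU1P: (subsetP KD g gK) => // eqg; rewrite eqg eqxx in gf.
case/negP: ncmp; apply/orP; right; apply/subsetP => h hD.
have [hK|hK] := boolP (h \in K); first exact: subsetP (key K KN fK KD) h hK.
have [L [LN hL LDK]] := strong_elimination DN KN gD gK hD hK.
have LD : L \subset f |: D.
  apply: subset_trans LDK (subset_trans (subsetDl _ _) _).
  by rewrite subUset subsetUr.
have [fL|fL] := boolP (f \in L); first exact: subsetP (key L LN fL LD) h hL.
have LsD : L \subset D.
  apply/subsetP => z zL; case/setU1P: (subsetP LD z zL) => // eqz.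
  by rewrite -eqz zL in fL.
by move/subsetP: LDK => /(_ g); rewrite (circuit_eq DN LN LsD) gD !inE eqxx => /(_ isT).
Qed.

(** The circuit [K] that [e] closes with [C] is comparable with [D]. If [K] lies in [cl N D], a
    second element of [K], found by [noloop], belongs to [C] and reduces to [cl_comparable_mem]. *)
Lemma cl_comparable_meet C D e : C \in circuits N -> D \in circuits N ->
  e \in cl N C -> e \in cl N D -> cl_comparable N C D.
Proof.
move=> CN DN eC eD; have [eC'|eC'] := boolP (e \in C); first exact: cl_comparable_mem eC' eD.
have [K [KN eK KC]] := cl_circuit eC eC'.
case/orP: (cl_comparable_mem KN DN eK eD) => [KD|DK]; last first.
  apply/orP; right; apply: subset_trans DK (cl_min _).
  by apply: subset_trans KC _; rewrite subUset sub1set eC sub_cl ?circuit_ground.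
have [g gK ge] : exists2 g, g \in K & g != e.
  apply/exists_inP; apply: contraT => /exists_inPn h.
  have [_ nK _] := circuitP _ _ KN; case/negP: nK.
  apply: indep_sub (noloop (subsetP (cl_sub_ground N C) e eC)) _.
  by apply/subsetP => g /h; rewrite negbK inE.
apply: (@cl_comparable_mem _ _ g) => //; last exact: subsetP KD g gK.
by case/setU1P: (subsetP KC g gK) => // eqg; rewrite eqg eqxx in ge.
Qed.

(** The rank equality makes [P] and [Q] skew after contracting [A], so [Q] does not help to span an
    element of [P]. *)
Lemma modular_cl A P Q P1 x :
    rk N (P :|: A) + rk N (Q :|: A) = rk N (P :|: Q :|: A) + rk N A ->
    x \in P -> P1 \subset P -> x \in cl N (P1 :|: Q :|: A) ->
  x \in cl N (P1 :|: A).
Proof.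
move=> modPQ; have eqr X : X \subset P ->
    rk N (X :|: Q :|: A) + rk N A = rk N (Q :|: A) + rk N (X :|: A).
  move=> XP; apply/eqP; rewrite eqn_leq; apply/andP; split.
    have := @rk_submodS _ N A (Q :|: A) (X :|: A) (subsetUr _ _) (subsetUr _ _).
    by rewrite setUACA setUid [Q :|: X]setUC.
  have := @rk_submodS _ N (X :|: A) (P :|: A) (X :|: Q :|: A) (setSU _ XP).
  rewrite setUSS ?subsetUl // => /(_ isT).
  rewrite setUACA setUid setUA (setUidPl XP); lia.
move=> xP P1P /setIdP[xE]; rewrite inE xE /= !setUA => /eqP eqx.
have := eqr P1 P1P; have := eqr (x |: P1); rewrite subUset sub1set xP => /(_ P1P).
rewrite eqx => -> /eqP; rewrite eqn_add2l => /eqP ->; exact: eqxx.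
Qed.

Hypothesis connN : {in E &, forall x y, same_component N x y}.

(** From a circuit [L] through [x] and a point of [C], [modular_cl] removes the part in [Q]. The
    resulting [K] still meets [cl N C], as otherwise it would equal [L]; since [x] is off [cl N C],
    comparability leaves only that [K] spans [C]. *)
Lemma circuit_through_closure C P Q x : C \in circuits N ->
    rk N (P :|: cl N C) + rk N (Q :|: cl N C) =
      rk N (P :|: Q :|: cl N C) + rk N (cl N C) ->
    E \subset P :|: Q :|: cl N C -> x \in E -> x \in P -> x \notin cl N C ->
  exists K, [/\ K \in circuits N, x \in K, K \subset P :|: cl N C & C \subset cl N K].
Proof.
move=> CN modPQ EPQ xE xP xA; have CE := circuit_ground CN.
have [c cC] := set0Pn _ (circuit_neq0 CN).
have cA : c \in cl N C := subsetP (sub_cl CE) c cC.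
case/predU1P: (connN xE (subsetP CE c cC)) => [eqxc|]; first by rewrite eqxc cA in xA.
case/exists_inP => L LN /andP[xL cL].
have LE := circuit_ground LN.
have xLP : x \in cl N ((L :&: P) :\ x :|: cl N C).
  apply: (modular_cl modPQ xP); first by rewrite (subset_trans (subsetDl _ _)) ?subsetIr.
  apply: subsetP (clS _ _) _ (circuit_cl LN xL); apply/subsetP => z /setD1P[zx zL].
  by have := subsetP EPQ z (subsetP LE z zL); rewrite !in_setU !inE zx zL.
have [|K [KN xK KL]] := cl_circuit xLP.
  by rewrite in_setU (negPf xA) orbF !inE eqxx.
exists K; split=> //.
  apply: subset_trans KL _; rewrite subUset sub1set inE xP /= setSU //.
  by rewrite (subset_trans (subsetDl _ _)) ?subsetIr.
have [e eK eA] : exists2 e, e \in K & e \in cl N C.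
  apply/exists_inP; apply: contraT => /exists_inPn h.
  have KsL : K \subset L.
    apply/subsetP => z zK; case/setU1P: (subsetP KL z zK) => [->//|].
    by rewrite in_setU (negPf (h z zK)) orbF !inE => /andP[_ /andP[]].
  by have := h c; rewrite (circuit_eq LN KN KsL) cL cA => /(_ isT).
have eKcl : e \in cl N K := subsetP (sub_cl (circuit_ground KN)) e eK.
case/orP: (cl_comparable_meet KN CN eKcl eA) => // KC.
by rewrite (subsetP KC) in xA.
Qed.

(* The contraction of a circuit closure A is connected: otherwise its         *)
(* separation (P, Q) yields circuits in [P :|: A] and [Q :|: A] whose         *)
(* closures both contain A, hence are cl_comparable, against modularity.         *)
Lemma cocircuit_off_closure C x y : C \in circuits N -> x != y ->
    x \in E -> x \notin cl N C -> y \in E -> y \notin cl N C ->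
  exists D, [/\ D \in circuits (dual N), x \in D, y \in D & D \subset E :\: cl N C].
Proof.
move=> CN xy xE xA yE yA; have AE := cl_sub_ground N C.
(* [R] is the dual of the contraction of [A]. Its circuits are the cocircuits avoiding [A], so it
   suffices that [x] and [y] share a component of [R]. *)
set A := cl N C in xA yA AE *; set R := restriction (dual N) (E :\: A).
have RE : E :\: A \subset ground (dual N) := subsetDl _ _.
have gR : ground R = E :\: A := restriction_ground RE.
have [|P PR xP] := @ex_component _ R x; first by rewrite gR in_setD xA.
have PEA : P \subset E :\: A by rewrite -gR component_sub.
have [yP|yP] := boolP (y \in P).
  have := component_connected PR xP yP; rewrite /same_component (negPf xy) /=.
  case/exists_inP => D; rewrite restriction_circuits // => /andP[DN DEA] /andP[xD yD].
  by exists D.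
have PE : P \subset E := subset_trans PEA (subsetDl _ _).
set Q := E :\: A :\: P.
have yQ : y \in Q by rewrite !in_setD yP yA.
have QE : Q \subset E := subset_trans (subsetDl _ _) (subsetDl _ _).
have EPQ : P :|: Q :|: A = E.
  apply/setP => z; rewrite in_setU in_setU in_setD in_setD.
  have [zP|] := boolP (z \in P); first by rewrite (subsetP PE).
  by have [/(subsetP AE) ->|] := boolP (z \in A); rewrite ?orbT ?orbF //= .
have EP : E :\: P = Q :|: A.
  apply/setP => z; rewrite !in_setU !in_setD.
  have [zP|] := boolP (z \in P).
    by have /setDP[_ /negPf->] := subsetP PEA z zP.
  by have [/(subsetP AE) ->|] := boolP (z \in A); rewrite ?orbT ?orbF //= .
have EQ : E :\: Q = P :|: A.
  rewrite /Q setDDr setDDr setDv set0U (setIidPr AE) (setIidPr PE).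
  by rewrite setUC.
(* By the corank formula, the separation of [R] becomes modularity of [P] and [Q] over [A]. *)
have modPQ : rk N (P :|: A) + rk N (Q :|: A) = rk N (P :|: Q :|: A) + rk N A.
  have := component_separator PR; rewrite /separator gR -/Q => /eqP.
  rewrite !rk_restriction ?subsetDl //.
  have := rk_dual PE; rewrite EP; have := rk_dual QE; rewrite EQ.
  have := rk_dual (subsetDl E A); rewrite setDDr setDv set0U (setIidPr AE).
  have := cardsID P (E :\: A); rewrite (setIidPr PEA) -/Q EPQ.
  move: (rk (dual N) P) (rk (dual N) Q) (rk (dual N) (E :\: A)) (rk N E) (rk N A).
  move: (rk N (P :|: A)) (rk N (Q :|: A)) #|P| #|Q| #|E :\: A|.
  by clear; lia.
have modQP : rk N (Q :|: A) + rk N (P :|: A) = rk N (Q :|: P :|: A) + rk N A.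
  by rewrite addnC modPQ [P :|: Q]setUC.
have EsPQ : E \subset P :|: Q :|: A by rewrite EPQ.
have EsQP : E \subset Q :|: P :|: A by rewrite [Q :|: P]setUC EPQ.
have [K [KN xK KP CK]] := circuit_through_closure CN modPQ EsPQ xE xP xA.
have [L [LN yL LQ CL]] := circuit_through_closure CN modQP EsQP yE yQ yA.
have [c cC] := set0Pn _ (circuit_neq0 CN).
have clA z : z \in cl N (set0 :|: A) -> z \in A.
  by rewrite set0U; apply: subsetP; apply: cl_min.
case/orP: (cl_comparable_meet KN LN (subsetP CK c cC) (subsetP CL c cC)) => s.
  case/negP: xA; apply: clA; apply: (modular_cl modPQ xP (sub0set _)).
  by rewrite set0U; apply: subsetP (clS _ LQ) _ (subsetP s x xK).
case/negP: yA; apply: clA; apply: (modular_cl modQP yQ (sub0set _)).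
by rewrite set0U; apply: subsetP (clS _ KP) _ (subsetP s y yL).
Qed.

Hypothesis lam_dualN : laminar_circuits (dual N).

Lemma incomparable_cover C1 C2 : C1 \in circuits N -> C2 \in circuits N ->
  ~~ cl_comparable N C1 C2 -> E \subset cl N C1 :|: cl N C2.
Proof.
move=> C1N C2N /norP[/subsetPn[y2 y2C y2A] /subsetPn[y1 y1C y1A]].
apply/subsetP => x xE; apply: contraT; rewrite in_setU => /norP[xA1 xA2].
have C1cl := sub_cl (circuit_ground C1N); have C2cl := sub_cl (circuit_ground C2N).
(* If [D2] spanned [D1] in the dual, the cocircuit that [y] closes with [D2] would meet [C] in [y]
   alone. *)
have key C D1 D2 y : C \in circuits N -> D2 \in circuits (dual N) ->
    y \in C -> y \in D1 -> D2 \subset E :\: cl N C -> D1 \subset cl (dual N) D2 -> false.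
  move=> CN D2N yC yD1 D2E D12.
  have Ccl := sub_cl (circuit_ground CN).
  have dD2 z : z \in C -> z \notin D2.
    by move=> zC; apply: contraL (subsetP Ccl z zC) => /(subsetP D2E)/setDP[].
  have [D [DN yD DD2]] := cl_circuit (subsetP D12 y yD1) (dD2 y yC).
  suff eqy : C :&: D = [set y] by have := circuit_cocircuit y CN DN; rewrite eqy eqxx.
  apply/setP => z; rewrite !inE; apply/andP/eqP => [[zC zD]|->//].
  by case/setU1P: (subsetP DD2 z zD) => // zD2; have := dD2 z zC; rewrite zD2.
have [||D1 [D1N xD1 yD1 D1E]] := @cocircuit_off_closure C1 x y1 C1N _ xE xA1 _ y1A.
- by apply: contraNneq xA2 => ->; apply: (subsetP C2cl).
- exact: subsetP (circuit_ground C2N) _ y1C.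
have [||D2 [D2N xD2 yD2 D2E]] := @cocircuit_off_closure C2 x y2 C2N _ xE xA2 _ y2A.
- by apply: contraNneq xA1 => ->; apply: (subsetP C1cl).
- exact: subsetP (circuit_ground C1N) _ y2C.
have /orP[s|s] : cl_comparable (dual N) D1 D2.
- by apply: lam_dualN => //; apply/set0Pn; exists x; rewrite inE xD1.
- by have := key C2 D1 D2 y1 C2N D2N y1C yD1 D2E s.
- by have := key C1 D2 D1 y2 C1N D1N y2C yD2 D1E s.
Qed.

Lemma incomparable_disjoint C1 C2 : C1 \in circuits N -> C2 \in circuits N ->
  ~~ cl_comparable N C1 C2 -> [disjoint cl N C1 & cl N C2].
Proof.
move=> C1N C2N; apply: contraNT; rewrite -setI_eq0 => /set0Pn[e /setIP[e1 e2]].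
exact: cl_comparable_meet e1 e2.
Qed.

(** [D] is again incomparable with [C2], so [cl N D] and [cl N C2] cover the ground set, and
    [cl N C1] avoids the latter. *)
Lemma incomparable_hyper C1 C2 D : C1 \in circuits N -> C2 \in circuits N ->
    ~~ cl_comparable N C1 C2 -> D \in circuits N -> D \subset cl N C1 ->
  cl N C1 \subset cl N D.
Proof.
move=> C1N C2N nc DN DA; have dis := incomparable_disjoint C1N C2N nc.
have C2cl := sub_cl (circuit_ground C2N).
have disj X : X != set0 -> X \subset cl N C1 -> X \subset cl N C2 -> false.
  move=> /set0Pn[z zX] X1 X2.
  by have := disjointFr dis (subsetP X1 z zX); rewrite (subsetP X2).
have ncD : ~~ cl_comparable N D C2.
  apply/negP => /orP[s|s]; first by have := disj D (circuit_neq0 DN) DA s.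
  by have := disj C2 (circuit_neq0 C2N) (subset_trans s (cl_min DA)) C2cl.
apply/subsetP => z z1.
have := subsetP (incomparable_cover DN C2N ncD) z (subsetP (cl_sub_ground _ _) z z1).
by case/setUP => // z2; have := disjointFr dis z1; rewrite z2.
Qed.

(** By the cover [D] meets both closures; contained in neither, it spans each by comparability. *)
Lemma incomparable_spanning C1 C2 D : C1 \in circuits N -> C2 \in circuits N ->
    ~~ cl_comparable N C1 C2 -> D \in circuits N -> ~~ (D \subset cl N C1) ->
    ~~ (D \subset cl N C2) -> E \subset cl N D.
Proof.
move=> C1N C2N nc DN nD1 nD2; have DE := circuit_ground DN.
have cov := incomparable_cover C1N C2N nc.
have sub C : C \in circuits N -> ~~ (D \subset cl N C) ->
    (exists2 e, e \in D & e \in cl N C) -> cl N C \subset cl N D.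
  move=> CN nDC [e eD eC]; apply: cl_min.
  have := cl_comparable_meet DN CN (subsetP (sub_cl DE) e eD) eC.
  by rewrite /cl_comparable (negPf nDC).
apply: (subset_trans cov); rewrite subUset.
have [e1 e1D e12] := subsetPn nD2; have [e2 e2D e21] := subsetPn nD1.
rewrite !sub //.
- exists e2 => //; case/setUP: (subsetP cov e2 (subsetP DE e2 e2D)) => // h.
  by rewrite h in e21.
- exists e1 => //; case/setUP: (subsetP cov e1 (subsetP DE e1 e1D)) => // h.
  by rewrite h in e12.
Qed.

Lemma incomparable_truncated C1 C2 : C1 \in circuits N -> C2 \in circuits N ->
  ~~ cl_comparable N C1 C2 -> truncated_sum_of_two_uniform N.
Proof.
move=> C1N C2N nc; set A := cl N C1; set B := cl N C2.
have AE : A \subset E := cl_sub_ground _ _; have BE : B \subset E := cl_sub_ground _ _.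
have nc' : ~~ cl_comparable N C2 C1 by rewrite cl_comparable_sym.
have gA := restriction_ground AE; have gB := restriction_ground BE.
have disAB : [disjoint ground (restriction N A) & ground (restriction N B)].
  by rewrite gA gB; apply: incomparable_disjoint.
have unif C C' : C \in circuits N -> C' \in circuits N -> ~~ cl_comparable N C C' ->
    uniform (restriction N (cl N C)) /\ 0 < rank (restriction N (cl N C)).
  move=> CN C'N ncC; have clE := cl_sub_ground N C; have gC := restriction_ground clE.
  have rkC : rank (restriction N (cl N C)) = rk N C.
    by rewrite rank_rk gC rk_restriction // rk_cl.
  split; last first.
    rewrite rkC; have [c cC] := set0Pn _ (circuit_neq0 CN).
    have cE := subsetP (circuit_ground CN) c cC.
    by rewrite -(cards1 c) rk_ge ?noloop // sub1set.
  exists (rk N C); rewrite gC; first by rewrite -rk_cl rk_card.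
  apply/setP => I; rewrite !inE andbC; have [IC|//] := boolP (I \subset cl N C).
  apply/idP/idP => [IN|leI]; first by rewrite -rk_cl rk_ge.
  apply/negPn/negP => /(dep_circuit (subset_trans IC clE))[D DN DI].
  have := rkS N (incomparable_hyper CN C'N ncC DN (subset_trans DI IC)).
  rewrite !rk_cl => leD; have := subset_leq_card DI; rewrite -(circuit_rk DN).
  by rewrite ltnNge (leq_trans leI).
exists (restriction N A), (restriction N B), disAB, (rk N E).
have EAB : ground N = A :|: B.
  by apply/eqP; rewrite eqEsubset incomparable_cover //= subUset AE.
have [uA rA] := unif C1 C2 C1N C2N nc; have [uB rB] := unif C2 C1 C2N C1N nc'.
split=> //.
  apply/andP; split.
    by apply: leq_trans rA _; rewrite rank_rk gA rk_restriction // rkS.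
  have [I [IN IE <-]] := rk_witness N E.
  apply: (@leq_bigmax_cond _ _ (fun X : {set T} => #|X|)).
  apply/imset2P; exists (I :&: A) (I :&: B); rewrite ?inE ?subsetIr ?andbT.
  - by apply: indep_sub IN _; apply: subsetIl.
  - by apply: indep_sub IN _; apply: subsetIl.
  - by rewrite -setIUr -EAB (setIidPl IE).
apply: matroid_eq; first by rewrite /= -/(ground _) -setIUr -EAB setIid.
apply/setP => I; rewrite inE; apply/idP/andP => [IN|[/imset2P[I1 I2]]].
  have IE := indep_ground IN; rewrite rk_ge //; split=> //.
  apply/imset2P; exists (I :&: A) (I :&: B); rewrite ?inE ?subsetIr ?andbT.
  - by apply: indep_sub IN _; apply: subsetIl.
  - by apply: indep_sub IN _; apply: subsetIl.
  - by rewrite -setIUr -EAB (setIidPl IE).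
rewrite !inE => /andP[I1N I1A] /andP[I2N I2B] eqI leI.
have IE : I \subset E by rewrite eqI subUset !indep_ground.
have dis := incomparable_disjoint C1N C2N nc.
apply/negPn/negP => /(dep_circuit IE)[D DN DI].
have [_ nD _] := circuitP _ _ DN.
have nDA : ~~ (D \subset A).
  apply: contra nD => DA; apply: indep_sub I1N _; apply/subsetP => z zD.
  have := subsetP DI z zD; rewrite eqI => /setUP[//|/(subsetP I2B)].
  by rewrite (disjointFr dis (subsetP DA z zD)).
have nDB : ~~ (D \subset B).
  apply: contra nD => DB; apply: indep_sub I2N _; apply/subsetP => z zD.
  have := subsetP DI z zD; rewrite eqI => /setUP[/(subsetP I1A)|//].
  by rewrite (disjointFl dis (subsetP DB z zD)).
have := rkS N (incomparable_spanning C1N C2N nc DN nDA nDB); rewrite rk_cl => leE.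
have := subset_leq_card DI; rewrite -(circuit_rk DN) ltnNge.
by rewrite (leq_trans leI).
Qed.

End Connected.

(** * The dichotomy and the passage between a matroid and its components *)

Lemma connected_dichotomy (T : finType) (N : matroid T) :
    laminar_circuits N -> laminar_circuits (dual N) -> {in ground N &, forall x y, same_component N x y} ->
  nested N \/ truncated_sum_of_two_uniform N.
Proof.
move=> sN sN' conn.
have [/forall_inP cmp|] :=
  boolP [forall C in circuits N, forall D in circuits N, cl_comparable N C D].
  by left; apply: nested_of_comparable => C D /cmp/forall_inP; apply.
case/forall_inPn => C1 C1N /forall_inPn[C2 C2N nc]; right.
apply: (incomparable_truncated sN _ conn sN' C1N C2N nc) => x xE.
have C1E := circuit_ground C1N; have C2E := circuit_ground C2N.
(* Two circuits inside a single point would be comparable, so a second element exists; a circuit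
   through both shows that [x] is no loop. *)
have [y yE xy] : exists2 y, y \in ground N & x != y.
  apply/exists_inP; apply: contraT => /exists_inPn h.
  have eqx z : z \in ground N -> z = x by move/h; rewrite negbK => /eqP.
  case/negP: nc; apply/orP; left; apply: subset_trans (sub_cl C2E).
  have [z zC2] := set0Pn _ (circuit_neq0 C2N).
  apply/subsetP => u uC1; rewrite (eqx u) ?(subsetP C1E) //.
  by rewrite -(eqx z) // (subsetP C2E).
have := conn x y xE yE; rewrite /same_component (negPf xy) /=.
case/exists_inP => L LN /andP[xL yL]; have [_ _ minL] := circuitP _ _ LN.
by apply: indep_sub (minL y yL) _; rewrite sub1set !inE xy.
Qed.

Theorem proposition4p4 (T : finType) (M : matroid T) :
  (laminar M /\ laminar (dual M)) <->
  (forall N : matroid T, is_component N M ->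
     nested N \/ truncated_sum_of_two_uniform N).
Proof.
split=> [[/capture_of_laminar/laminar_capture_circuits sM /capture_of_laminar/laminar_capture_circuits sM'] _ [X XM ->]|h].
  have XE := component_sub XM; have sepX := component_separator XM.
  apply: connected_dichotomy.
  - apply: laminar_circuits_eq_rk sM.
    + exact: restriction_ground.
    + exact: XE.
    + exact: rk_restriction.
  - apply: (@laminar_circuits_eq_rk _ (dual M) _ X) => //; first exact: restriction_ground.
    by move=> Z; apply: rk_dual_restriction.
  rewrite restriction_ground // => x y xX yX.
  case/predU1P: (component_connected XM xX yX) => [->|].
    by rewrite /same_component eqxx.
  case/exists_inP => C CM /andP[xC yC]; apply/orP; right; apply/exists_inP; exists C.
    rewrite restriction_circuits // CM (component_circuit XM CM) //.
    by apply/set0Pn; exists x; rewrite inE xC.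
  by rewrite xC.
have /and3P[_ tP _] := equivalence_partitionP (@same_component_equiv _ M).
have {}h X : X \in connected_components M ->
    laminar_capture (restriction M X) /\ laminar_capture (dual (restriction M X)).
  move=> XM; have [|/nested_capture//|/truncated_sum_capture//] := h (restriction M X).
  by exists X.
have ex (M' : matroid T) C : ground M' = ground M -> C \in circuits M' ->
    exists2 X, X \in connected_components M & C :&: X != set0.
  move=> gM' CM; have [x xC] := set0Pn _ (circuit_neq0 CM).
  have [|X XM xX] := @ex_component _ M x.
    by rewrite -gM' (subsetP (circuit_ground CM)).
  by exists X => //; apply/set0Pn; exists x; rewrite inE xC.
split; apply: laminar_of_capture; apply: (laminar_capture_glue (P := connected_components M)) => //;
  try exact: component_sub.
- move=> C CM; have [X XM CX] := ex M C erefl CM.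
  by exists X; rewrite // (component_circuit XM CM CX).
- move=> X XM; have [[A lamA capA] _] := h X XM; have XE := component_sub XM.
  rewrite restriction_ground // in lamA.
  exists A => // C CM CX; have [|F FA [CF ltF]] := capA C.
    by rewrite restriction_circuits // CM.
  by exists F => //; rewrite rk_restriction ?lamA.1 // in ltF.
(* The components of M serve for the dual: they are separators there, so each cocircuit lies in one
   of them. *)
- move=> C CM; have [X XM CX] := ex (dual M) C erefl CM.
  exists X => //; have XE := component_sub XM.
  apply: (separator_circuit (M := dual M)) CX => //.
  exact: dual_separator (component_separator XM).
- move=> X XM; have [_ [A lamA capA]] := h X XM; have XE := component_sub XM.
  have sepX := component_separator XM.
  have {}lamA : laminar_family X A by rewrite /= (setIidPr XE) in lamA.
  exists A => // C CM CX; have [|F FA [CF ltF]] := capA C.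
    by rewrite dual_restriction_circuits // CM.
  by exists F => //; rewrite rk_dual_restriction ?lamA.1 // in ltF.
Qed.
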